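(* $LW_{1^-}=\{w\in\mathbb C: |\operatorname{Im} w|<3\pi/2\}.$
   Context: $\mathbb D=\{z\in\mathbb C:|z|<1\}$. An analytic function $g$ on $\mathbb D$ with $g(0)=g'(0)-1=0$ is called convex if it is univalent and $g(\mathbb D)$ is a convex set. $\mathcal C$ denotes the class of close-to-convex functions, that is, analytic functions $f$ on $\mathbb D$ with $f(0)=f'(0)-1=0$ such that $\operatorname{Re}[e^{i\lambda}f'(z)/g'(z)]>0$ for all $z\in\mathbb D$, for some convex function $g$ (normalized by $g(0)=g'(0)-1=0$) and some real constant $\lambda$ with $|\lambda|<\pi/2$. Every $f\in\mathcal C$ is univalent, so $zf'(z)/f(z)$ (with value $1$ at $z=0$) is a non-vanishing analytic function on $\mathbb D$; $\log\frac{zf'(z)}{f(z)}$ denotes the continuous branch on $\mathbb D$ with value $0$ at $z=0$. For $z\in\mathbb D$, $LW_z=\{\log\frac{zf'(z)}{f(z)}:f\in\mathcal C\}$, and $LW_{1^-}=\bigcup_{0\le r<1}LW_r$. *)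

(* Defs.v *)
From Stdlib Require Export Reals.
From Coquelicot Require Export Coquelicot.
Open Scope R_scope.
Open Scope C_scope.

Definition disc (z : C) : Prop := (Cmod z < 1)%R.

(* Functions on the disc are total functions [C -> C] whose values outside the
   disc are irrelevant: the disc is open, so complex differentiability and
   continuity at its points only depend on the restriction. *)
Definition analytic (f : C -> C) : Prop :=
  forall z, disc z -> @ex_derive C_AbsRing C_NormedModule f z.

(* [C_derive f z] is the limit of the difference quotient along real increments;
   it equals the complex derivative wherever the latter exists
   ([C_derive_correct]), and is only used for functions that are [analytic]. *)
Definition normalized (f : C -> C) : Prop :=
  f 0 = 0 /\ C_derive f 0 - 1 = 0.

Definition univalent (f : C -> C) : Prop :=
  analytic f /\
  forall z1 z2, disc z1 -> disc z2 -> f z1 = f z2 -> z1 = z2.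

Definition image_disc (f : C -> C) (w : C) : Prop :=
  exists z, disc z /\ f z = w.

Definition convex_set (A : C -> Prop) : Prop :=
  forall u v (t : R), A u -> A v -> (0 <= t <= 1)%R ->
    A (RtoC (1 - t) * u + RtoC t * v).

Definition convex_function (g : C -> C) : Prop :=
  normalized g /\ univalent g /\ convex_set (image_disc g).

Definition Cexp (z : C) : C :=
  RtoC (exp (Re z)) * (RtoC (cos (Im z)) + Ci * RtoC (sin (Im z))).

Definition close_to_convex (f : C -> C) : Prop :=
  analytic f /\ normalized f /\
  exists (g : C -> C) (lambda : R),
    convex_function g /\ (Rabs lambda < PI / 2)%R /\
    forall z, disc z ->
      (0 < Re (Cexp (Ci * RtoC lambda) * (C_derive f z / C_derive g z)))%R.

Definition zf'_over_f (f : C -> C) (z : C) : C :=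
  if Ceq_dec z 0 then 1 else z * C_derive f z / f z.

(* Two continuous logarithms on the connected disc that agree at 0 coincide, so
   this relation determines [L] on the disc. *)
Definition log_branch (h L : C -> C) : Prop :=
  (forall z, disc z -> @continuous C_UniformSpace C_UniformSpace L z) /\
  L 0 = 0 /\
  forall z, disc z -> Cexp (L z) = h z.

Definition LW (z w : C) : Prop :=
  exists f L : C -> C,
    close_to_convex f /\ log_branch (zf'_over_f f) L /\ w = L z.

Definition LW_1minus (w : C) : Prop :=
  exists r : R, (0 <= r < 1)%R /\ LW (RtoC r) w.

(* Main.v *)
(** Let [f] be close-to-convex with respect to [g] and [lambda], and put
    [S = e^(i lambda) f/g] and [M = S e^L = e^(i lambda) z f'/g].  Integrating
    [f'/g'] along the preimage of a segment of the convex set [g(D)] gives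
    [Re S > 0].  Schwarz's lemma for [g^-1(t g(z))] shows that [Re (z g'/g) >= 0],
    and [M] is the product of [e^(i lambda) f'/g'] with [z g'/g], so [M] avoids the
    nonpositive reals.  Hence the principal arguments of [M] and [S] are continuous,
    [Im L = Arg M - Arg S] along the radius, and this is less than [pi + pi/2] in
    modulus.  Schwarz's lemma comes from Goursat's theorem in logarithmic polar
    coordinates, which needs no continuity of the derivative.

    Conversely, for [x], [y] in the disc the function
    [f = (z - (x+y)/2 z^2)/(1 - yz)^2] has [f' = (1 - xz)/(1 - yz)^3] and is
    close-to-convex with respect to [g = z/(1 - yz)].  With [u = 1 - xr] and
    [v = 1 - yr] the logarithm at [r] is [- Log v - Log ((1 + v/u)/2)]; the value
    [X + iY] is obtained for [Arg v = - Y/3] and [|v|] small enough, [u] being then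
    determined by [v]. *)

Require Import Defs.
From Stdlib Require Import Lra Lia ClassicalEpsilon Ranalysis5.

Local Open Scope R_scope.

(** Analyticity is bare differentiability at each point, and this shapes the analytic part. The
    quotients [f(z)/z], [g(z)/z] and [h(z)/z] are the factors that the derivative at the origin
    supplies, continuous there by definition, and the inverse of [g] is handled through a minimum of
    [|g - y|] on a small disc. The equation [M = S e^L] ties [Im L] to [Arg M - Arg S] only modulo
    [2 pi]. Equality follows from continuity on the segment from 0 to [r], because both sides vanish
    at 0. When [|x| = |y| = 1] and [x], [y] are distinct, the functions [f] are the extreme points
    of the closed convex hull of the close-to-convex functions. Taking [x], [y] in the open disc
    makes [u] and [v] independent points of the disc of radius [r] about 1, so that a prescribed
    value is reached by solving explicitly. The two logarithms have imaginary parts below [pi/2] and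
    [pi]. Sharing [Y] between them in the ratio 1 : 2 keeps both within range for every admissible
    [Y], whence the angle [- Y/3]. *)

Local Notation CU := (AbsRing_UniformSpace C_AbsRing).

(** * Moduli and continuity of complex-valued functions *)

Lemma Cmod_sub_sym (z w : C) : Cmod (z - w) = Cmod (w - z).
Proof. rewrite <- Cmod_opp. f_equal. ring. Qed.

Lemma Cmod_triangle_rev (z w : C) : Cmod z - Cmod w <= Cmod (z - w).
Proof.
  generalize (Cmod_triangle (z - w) w).
  replace (z - w + w)%C with z by ring. lra.
Qed.

Lemma Re_le_Cmod (z : C) : Re z <= Cmod z.
Proof. generalize (re_le_Cmod z) (Rle_abs (Re z)); lra. Qed.

Lemma Im_le_Cmod (z : C) : Rabs (Im z) <= Cmod z.
Proof. exact (Rle_trans _ _ _ (Rmax_r _ _) (Rmax_Cmod z)). Qed.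

Lemma Cmod_le_Re_Im (z : C) : Cmod z <= Rabs (Re z) + Rabs (Im z).
Proof.
  apply Rsqr_incr_0_var.
  2: generalize (Rabs_pos (Re z)) (Rabs_pos (Im z)); lra.
  rewrite !Rsqr_pow2, Cmod2_alt.
  rewrite <- (pow2_abs (Re z)), <- (pow2_abs (Im z)).
  generalize (Rmult_le_pos _ _ (Rabs_pos (Re z)) (Rabs_pos (Im z))); nra.
Qed.

Lemma Cmod_sqr (z : C) : Cmod z * Cmod z = Re z * Re z + Im z * Im z.
Proof. generalize (Cmod2_alt z). simpl. lra. Qed.

Lemma C_ext (z w : C) : Re z = Re w -> Im z = Im w -> z = w.
Proof. destruct z, w; simpl; congruence. Qed.

Ltac C_ring := apply C_ext; unfold Re, Im; simpl; unfold Re, Im; simpl; ring.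

Lemma continuous_CU_iff (f : C -> C) (z : C) :
  @continuous CU CU f z <->
  (forall eps, 0 < eps -> exists del, 0 < del /\
     forall w, Cmod (w - z) < del -> Cmod (f w - f z) < eps).
Proof.
  split.
  - intros H eps He.
    destruct (H (ball (M := CU) (f z) eps)) as [d Hd].
    { exists (mkposreal eps He). now intros. }
    exists d. split; [apply cond_pos|]. intros w Hw. exact (Hd w Hw).
  - intros H P [e HP].
    destruct (H e (cond_pos e)) as [d [Hd H']].
    exists (mkposreal d Hd). intros w Hw. apply HP. exact (H' w Hw).
Qed.

Lemma continuous_CR_iff (f : C -> R) (z : C) :
  @continuous CU R_UniformSpace f z <->
  (forall eps, 0 < eps -> exists del, 0 < del /\
     forall w, Cmod (w - z) < del -> Rabs (f w - f z) < eps).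
Proof.
  split.
  - intros H eps He.
    destruct (H (ball (M := R_UniformSpace) (f z) eps)) as [d Hd].
    { exists (mkposreal eps He). now intros. }
    exists d. split; [apply cond_pos|]. intros w Hw. exact (Hd w Hw).
  - intros H P [e HP].
    destruct (H e (cond_pos e)) as [d [Hd H']].
    exists (mkposreal d Hd). intros w Hw. apply HP. exact (H' w Hw).
Qed.

(** [log_branch] uses the product uniform structure on [C], whereas derivatives refer to the
    structure [CU] of the modulus. The two have the same neighbourhoods. *)
Lemma continuous_C_CU (f : C -> C) (z : C) :
  @continuous C_UniformSpace C_UniformSpace f z <-> @continuous CU CU f z.
Proof.
  unfold continuous, filterlim, filter_le, filtermap. split; intros H P HP.
  - apply locally_C. apply H. now apply locally_C.
  - apply locally_C. apply H. now apply locally_C.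
Qed.

Section Continuity.
Context {U : UniformSpace}.
Implicit Types f g : U -> C.

Lemma continuous_Re f x : @continuous U CU f x -> continuous (fun t => Re (f t)) x.
Proof.
  intros H. apply (@continuous_comp U CU R_UniformSpace f Re); trivial.
  apply continuous_CR_iff. intros e He. exists e. split; trivial.
  intros w Hw. eapply Rle_lt_trans; [|exact Hw].
  exact (re_le_Cmod (w - f x)).
Qed.

Lemma continuous_Im f x : @continuous U CU f x -> continuous (fun t => Im (f t)) x.
Proof.
  intros H. apply (@continuous_comp U CU R_UniformSpace f Im); trivial.
  apply continuous_CR_iff. intros e He. exists e. split; trivial.
  intros w Hw. eapply Rle_lt_trans; [|exact Hw].
  exact (Im_le_Cmod (w - f x)).
Qed.

Lemma continuous_Cmod f x : @continuous U CU f x -> continuous (fun t => Cmod (f t)) x.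
Proof.
  intros H. apply (@continuous_comp U CU R_UniformSpace f Cmod); trivial.
  apply continuous_CR_iff. intros e He. exists e. split; trivial.
  intros w Hw. apply Rabs_def1.
  - generalize (Cmod_triangle_rev w (f x)). lra.
  - generalize (Cmod_triangle_rev (f x) w). rewrite Cmod_sub_sym. lra.
Qed.

Lemma continuous_Cplus f g x : @continuous U CU f x -> @continuous U CU g x ->
  @continuous U CU (fun t => (f t + g t)%C) x.
Proof. exact (@continuous_plus U C_AbsRing (AbsRing_NormedModule C_AbsRing) f g x). Qed.

Lemma continuous_Cmult f g x : @continuous U CU f x -> @continuous U CU g x ->
  @continuous U CU (fun t => (f t * g t)%C) x.
Proof. exact (@continuous_mult U C_AbsRing f g x). Qed.

Lemma continuous_Copp f x : @continuous U CU f x -> @continuous U CU (fun t => (- f t)%C) x.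
Proof. exact (@continuous_opp U C_AbsRing (AbsRing_NormedModule C_AbsRing) f x). Qed.

Lemma continuous_Cminus f g x : @continuous U CU f x -> @continuous U CU g x ->
  @continuous U CU (fun t => (f t - g t)%C) x.
Proof. intros Hf Hg. now apply continuous_Cplus; [|apply continuous_Copp]. Qed.

Lemma continuous_Cinv f x : f x <> 0 -> @continuous U CU f x ->
  @continuous U CU (fun t => (/ f t)%C) x.
Proof.
  intros H0 H. apply (@continuous_comp U CU CU f Cinv); trivial.
  apply continuous_CU_iff. intros e He. set (a := f x) in *.
  assert (Ha : 0 < Cmod a) by now apply Cmod_gt_0.
  (* The first bound keeps [|w|] above [|a|/2]; the second then makes [|a - w| / (|w| |a|)] smaller
     than [e]. *)
  exists (Rmin (Cmod a / 2) (e * Cmod a * Cmod a / 2)). split.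
  { apply Rmin_pos; [lra|]. assert (0 < e * Cmod a) by nra. nra. }
  intros w Hw.
  assert (H1 : Cmod (w - a) < Cmod a / 2) by (eapply Rlt_le_trans; [exact Hw|apply Rmin_l]).
  assert (H2 : Cmod (w - a) < e * Cmod a * Cmod a / 2) by (eapply Rlt_le_trans; [exact Hw|apply Rmin_r]).
  assert (Hw2 : Cmod a / 2 < Cmod w).
  { generalize (Cmod_triangle_rev a w). rewrite Cmod_sub_sym. lra. }
  assert (w <> 0) by (apply Cmod_gt_0; lra).
  replace (/ w - / a)%C with ((a - w) / (w * a))%C by (field; now split).
  rewrite Cmod_div by (apply Cmult_neq_0; trivial).
  rewrite Cmod_mult, Cmod_sub_sym.
  apply Rmult_lt_reg_r with (Cmod w * Cmod a); [nra|].
  unfold Rdiv at 1. rewrite Rmult_assoc, Rinv_l by nra.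
  assert (0 < e * Cmod a) by nra. nra.
Qed.

Lemma continuous_Cdiv f g x : g x <> 0 -> @continuous U CU f x -> @continuous U CU g x ->
  @continuous U CU (fun t => (f t / g t)%C) x.
Proof. intros H Hf Hg. now apply continuous_Cmult; [|apply continuous_Cinv]. Qed.

Lemma continuous_Cconst (c : C) x : @continuous U CU (fun _ => c) x.
Proof. exact (@continuous_const U CU c x). Qed.

Lemma continuous_RtoC (f : U -> R) x : continuous f x -> @continuous U CU (fun t => RtoC (f t)) x.
Proof.
  intros H. apply (@continuous_comp U R_UniformSpace CU f RtoC); trivial.
  intros P [e HP]. exists e. intros y Hy. apply HP.
  change (Cmod (RtoC y - RtoC (f x)) < e).
  rewrite <- RtoC_minus, Cmod_R. exact Hy.
Qed.

Lemma continuous_C_of_parts f x :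
  continuous (fun t => Re (f t)) x -> continuous (fun t => Im (f t)) x -> @continuous U CU f x.
Proof.
  intros H1 H2.
  apply (@continuous_ext U CU (fun t => RtoC (Re (f t)) + Ci * RtoC (Im (f t)))%C).
  { intros t. C_ring. }
  apply continuous_Cplus; [now apply continuous_RtoC|].
  apply continuous_Cmult; [apply continuous_Cconst|now apply continuous_RtoC].
Qed.
End Continuity.

(** * Complex derivatives *)

(* Caratheodory's formulation makes the product, chain and inverse function
   rules consequences of the algebra of continuous functions. *)
Definition has_deriv (f : C -> C) (z l : C) : Prop :=
  exists phi : C -> C, @continuous CU CU phi z /\ phi z = l /\
    forall w, (f w - f z = phi w * (w - z))%C.

Lemma has_deriv_iff (f : C -> C) (z l : C) :
  has_deriv f z l <->
  (forall eps, 0 < eps -> exists del, 0 < del /\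
     forall w, Cmod (w - z) < del ->
       Cmod (f w - f z - l * (w - z)) <= eps * Cmod (w - z)).
Proof.
  split.
  - intros [phi [Hc [Hl Hf]]] e He.
    destruct (proj1 (continuous_CU_iff phi z) Hc e He) as [d [Hd H]].
    exists d. split; trivial. intros w Hw.
    rewrite Hf, <- Hl.
    replace (phi w * (w - z) - phi z * (w - z))%C with ((phi w - phi z) * (w - z))%C by ring.
    rewrite Cmod_mult. apply Rmult_le_compat_r; [apply Cmod_ge_0|].
    left. now apply H.
  - intros H.
    exists (fun w => if Ceq_dec w z then l else ((f w - f z) / (w - z))%C).
    assert (Hz : (if Ceq_dec z z then l else ((f z - f z) / (z - z))%C) = l)
      by (destruct (Ceq_dec z z); congruence).
    split; [|split]; trivial.
    + apply continuous_CU_iff. rewrite Hz. intros e He.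
      destruct (H (e / 2)) as [d [Hd H']]; [lra|].
      exists d. split; trivial. intros w Hw.
      destruct (Ceq_dec w z) as [E|E].
      * replace (l - l)%C with (RtoC 0) by ring. now rewrite Cmod_0.
      * assert (Hn : (w - z)%C <> 0) by now apply Cminus_eq_contra.
        replace ((f w - f z) / (w - z) - l)%C with ((f w - f z - l * (w - z)) / (w - z))%C
          by now field.
        rewrite Cmod_div by trivial.
        assert (0 < Cmod (w - z)) by now apply Cmod_gt_0.
        apply Rle_lt_trans with (e / 2); [|lra].
        apply Rmult_le_reg_r with (Cmod (w - z)); trivial.
        unfold Rdiv at 1. rewrite Rmult_assoc, Rinv_l, Rmult_1_r by lra.
        now apply H'.
    + intros w. destruct (Ceq_dec w z) as [E|E].
      * subst. ring.
      * field. now apply Cminus_eq_contra.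
Qed.

Lemma is_derive_iff (f : C -> C) (z l : C) :
  @is_derive C_AbsRing C_NormedModule f z l <-> has_deriv f z l.
Proof.
  rewrite has_deriv_iff. split.
  - intros [_ H] e He.
    destruct (H z (fun P HP => HP) (mkposreal e He)) as [d Hd].
    exists d. split; [apply cond_pos|]. intros w Hw.
    specialize (Hd w Hw). simpl in Hd.
    replace (f w - f z - l * (w - z))%C with (f w - f z - (w - z) * l)%C by ring.
    exact Hd.
  - intros H. split.
    { exact (is_linear_scal_l (K := C_AbsRing) (V := C_NormedModule) l). }
    intros x Hx e.
    rewrite <- (is_filter_lim_locally_unique (K := C_AbsRing) (V := AbsRing_NormedModule C_AbsRing) z x Hx).
    destruct (H e (cond_pos e)) as [d [Hd H']].
    exists (mkposreal d Hd). intros w Hw. specialize (H' w Hw).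
    change (Cmod (f w - f z - (w - z) * l) <= e * Cmod (w - z)).
    now replace (f w - f z - (w - z) * l)%C with (f w - f z - l * (w - z))%C by ring.
Qed.

Lemma has_deriv_C_derive (f : C -> C) (z : C) :
  @ex_derive C_AbsRing C_NormedModule f z -> has_deriv f z (C_derive f z).
Proof. intros H. apply is_derive_iff. exact (C_derive_correct f z z H). Qed.

Lemma C_derive_has_deriv (f : C -> C) (z l : C) : has_deriv f z l -> C_derive f z = l.
Proof. intros H. apply is_C_derive_unique. now apply is_derive_iff. Qed.

Lemma has_deriv_continuous f z l : has_deriv f z l -> @continuous CU CU f z.
Proof.
  intros [phi [Hc [_ Hf]]].
  apply (@continuous_ext CU CU (fun w => f z + phi w * (w - z))%C).
  { intros w. change ((f z + phi w * (w - z))%C = f w). rewrite <- Hf. ring. }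
  apply (@continuous_Cplus CU); [apply (@continuous_Cconst CU)|].
  apply (@continuous_Cmult CU); trivial.
  apply (@continuous_Cminus CU); [apply continuous_id|apply (@continuous_Cconst CU)].
Qed.

Lemma has_deriv_const (c z : C) : has_deriv (fun _ => c) z 0.
Proof.
  exists (fun _ => 0). split; [apply (@continuous_Cconst CU)|split; trivial]. intros; ring.
Qed.

Lemma has_deriv_id (z : C) : has_deriv (fun w => w) z 1.
Proof.
  exists (fun _ => 1). split; [apply (@continuous_Cconst CU)|split; trivial]. intros; ring.
Qed.

Lemma has_deriv_plus f g z l m : has_deriv f z l -> has_deriv g z m ->
  has_deriv (fun w => (f w + g w)%C) z (l + m).
Proof.
  intros [p [Hp [Lp Ep]]] [q [Hq [Lq Eq]]].
  exists (fun w => (p w + q w)%C). split; [|split].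
  - now apply (@continuous_Cplus CU).
  - congruence.
  - intros w. rewrite Cmult_plus_distr_r, <- Ep, <- Eq. ring.
Qed.

Lemma has_deriv_mult f g z l m : has_deriv f z l -> has_deriv g z m ->
  has_deriv (fun w => (f w * g w)%C) z (l * g z + f z * m).
Proof.
  intros Hf Hg. assert (Cg := has_deriv_continuous _ _ _ Hg).
  destruct Hf as [p [Hp [Lp Ep]]], Hg as [q [Hq [Lq Eq]]].
  exists (fun w => (p w * g w + f z * q w)%C). split; [|split].
  - apply (@continuous_Cplus CU); apply (@continuous_Cmult CU); trivial. apply (@continuous_Cconst CU).
  - congruence.
  - intros w.
    replace ((p w * g w + f z * q w) * (w - z))%C
      with ((p w * (w - z)) * g w + f z * (q w * (w - z)))%C by ring.
    rewrite <- Ep, <- Eq. ring.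
Qed.

Lemma has_deriv_scal c f z l : has_deriv f z l -> has_deriv (fun w => (c * f w)%C) z (c * l).
Proof.
  intros H. generalize (has_deriv_mult _ _ _ _ _ (has_deriv_const c z) H).
  now replace (0 * f z + c * l)%C with (c * l)%C by ring.
Qed.

Lemma has_deriv_comp f g z l m : has_deriv g z m -> has_deriv f (g z) l ->
  has_deriv (fun w => f (g w)) z (l * m).
Proof.
  intros Hg Hf. assert (Cg := has_deriv_continuous _ _ _ Hg).
  destruct Hf as [p [Hp [Lp Ep]]], Hg as [q [Hq [Lq Eq]]].
  exists (fun w => (p (g w) * q w)%C). split; [|split].
  - apply (@continuous_Cmult CU); trivial.
    now apply (@continuous_comp CU CU CU g p).
  - congruence.
  - intros w. rewrite Ep, Eq. ring.
Qed.

Lemma has_deriv_near f g z l :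
  (exists del, 0 < del /\ forall w, Cmod (w - z) < del -> f w = g w) ->
  has_deriv f z l -> has_deriv g z l.
Proof.
  intros [r [Hr E]] H. apply has_deriv_iff. intros e He.
  destruct (proj1 (has_deriv_iff _ _ _) H e He) as [d [Hd H']].
  exists (Rmin r d). split; [now apply Rmin_pos|].
  intros w Hw. rewrite <- !E.
  - apply H'. eapply Rlt_le_trans; [exact Hw|apply Rmin_r].
  - replace (z - z)%C with (RtoC 0) by ring. now rewrite Cmod_0.
  - eapply Rlt_le_trans; [exact Hw|apply Rmin_l].
Qed.

Lemma nonzero_near (f : C -> C) z : @continuous CU CU f z -> f z <> 0 ->
  exists del, 0 < del /\ forall w, Cmod (w - z) < del -> f w <> 0.
Proof.
  intros Hc H0. assert (Ha : 0 < Cmod (f z)) by now apply Cmod_gt_0.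
  destruct (proj1 (continuous_CU_iff _ _) Hc _ Ha) as [d [Hd H]].
  exists d. split; trivial. intros w Hw E. specialize (H w Hw).
  rewrite E, Cmod_sub_sym in H.
  replace (f z - 0)%C with (f z) in H by ring. lra.
Qed.

Lemma has_deriv_inv f z l : has_deriv f z l -> f z <> 0 ->
  has_deriv (fun w => (/ f w)%C) z (- l / (f z * f z)).
Proof.
  intros H H0.
  destruct (nonzero_near _ _ (has_deriv_continuous _ _ _ H) H0) as [r [Hr Hn]].
  assert (Hc := has_deriv_continuous _ _ _ H).
  destruct H as [p [Hp [Lp Ep]]].
  (* The factor identity must hold for every [w], also where [f w = 0]; there the plain difference
     quotient serves. Near [z] this branch is never taken, so continuity is that of the other
     one. *)
  exists (fun w => if Ceq_dec (f w) 0 then ((/ f w - / f z) / (w - z))%C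
                   else (- p w * / (f w * f z))%C). split; [|split].
  - apply (@continuous_ext_loc CU CU _ (fun w => (- p w * / (f w * f z))%C)).
    + exists (mkposreal r Hr). intros w Hw.
      destruct (Ceq_dec (f w) 0) as [E|E]; trivial. now elim (Hn w Hw).
    + apply (@continuous_Cmult CU); [now apply (@continuous_Copp CU)|].
      apply (@continuous_Cinv CU); [now apply Cmult_neq_0|].
      apply (@continuous_Cmult CU); trivial. apply (@continuous_Cconst CU).
  - destruct (Ceq_dec (f z) 0); [easy|]. now rewrite Lp.
  - intros w. destruct (Ceq_dec (f w) 0) as [E|E].
    + unfold Cdiv. rewrite <- Cmult_assoc, Cinv_l; [ring|].
      apply Cminus_eq_contra. congruence.
    + replace (- p w * / (f w * f z) * (w - z))%C with (- (p w * (w - z)) * / (f w * f z))%C by ring.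
      rewrite <- Ep. field. now split.
Qed.

(** * Subdivision of rectangles *)

(* A Cousin-type principle: a property of the rectangles
   [x, x + s w] * [y, y + s h] that passes from the four quarters to the whole
   holds as soon as it holds for small rectangles around every point. *)
Lemma quarter_induction (w h x0 y0 : R) (P : R -> R -> R -> Prop) :
  0 <= w -> 0 <= h ->
  (forall x y s, P x y (s / 2) -> P (x + s / 2 * w) y (s / 2) ->
     P x (y + s / 2 * h) (s / 2) -> P (x + s / 2 * w) (y + s / 2 * h) (s / 2) -> P x y s) ->
  (forall xi eta, x0 <= xi <= x0 + w -> y0 <= eta <= y0 + h ->
     exists del, 0 < del /\ forall x y s, 0 < s < del ->
       x <= xi <= x + s * w -> y <= eta <= y + s * h ->
       x0 <= x -> x + s * w <= x0 + w -> y0 <= y -> y + s * h <= y0 + h -> P x y s) ->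
  P x0 y0 1.
Proof.
  intros Hw Hh Hq Hloc. apply NNPP. intros HP.
  (* [q'] is a quarter of [q] that violates [P] if [q] does. The implication gives every triple a
     successor, so a step function can be chosen on all of them. *)
  set (good := fun (q q' : R * R * R) =>
    let '(x, y, s) := q in let '(x', y', s') := q' in
    s' = s / 2 /\ (x' = x \/ x' = x + s / 2 * w) /\ (y' = y \/ y' = y + s / 2 * h) /\
    (~ P x y s -> ~ P x' y' s')).
  assert (Hstep : forall q, exists q', good q q').
  { intros [[x y] s]. unfold good.
    destruct (classic (P x y (s / 2))) as [H1|H1].
    2: { exists (x, y, s / 2). tauto. }
    destruct (classic (P (x + s / 2 * w) y (s / 2))) as [H2|H2].
    2: { exists (x + s / 2 * w, y, s / 2). tauto. }
    destruct (classic (P x (y + s / 2 * h) (s / 2))) as [H3|H3].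
    2: { exists (x, y + s / 2 * h, s / 2). tauto. }
    exists (x + s / 2 * w, y + s / 2 * h, s / 2). repeat split; try tauto.
    intros HN H4. apply HN. now apply Hq. }
  set (step := fun q => proj1_sig (constructive_indefinite_description _ (Hstep q))).
  assert (Hs : forall q, good q (step q)).
  { intros q. unfold step. now destruct constructive_indefinite_description. }
  set (q := nat_rect (fun _ => (R * R * R)%type) (x0, y0, 1) (fun _ => step)).
  set (X := fun n => fst (fst (q n))). set (Y := fun n => snd (fst (q n))).
  set (S := fun n => snd (q n)).
  assert (Hn : forall n, S (Datatypes.S n) = S n / 2 /\
     (X (Datatypes.S n) = X n \/ X (Datatypes.S n) = X n + S n / 2 * w) /\
     (Y (Datatypes.S n) = Y n \/ Y (Datatypes.S n) = Y n + S n / 2 * h) /\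
     (~ P (X n) (Y n) (S n) -> ~ P (X (Datatypes.S n)) (Y (Datatypes.S n)) (S (Datatypes.S n)))).
  { intros n. unfold X, Y, S. simpl. generalize (Hs (q n)). unfold good.
    destruct (q n) as [[x y] s], (step (x, y, s)) as [[x' y'] s']. simpl. tauto. }
  assert (HS : forall n, S n = (/ 2) ^ n).
  { induction n; simpl; [reflexivity|]. destruct (Hn n) as [-> _]. rewrite IHn. lra. }
  assert (HSp : forall n, 0 < S n).
  { intros n. rewrite HS. apply pow_lt. lra. }
  assert (HN : forall n, ~ P (X n) (Y n) (S n)).
  { induction n; [exact HP|]. now apply Hn. }
  assert (Hmono : forall n k, X n <= X (n + k)%nat /\ X (n + k)%nat + S (n + k)%nat * w <= X n + S n * w
     /\ Y n <= Y (n + k)%nat /\ Y (n + k)%nat + S (n + k)%nat * h <= Y n + S n * h).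
  { intros n. induction k.
    - rewrite Nat.add_0_r. lra.
    - rewrite Nat.add_succ_r.
      destruct (Hn (n + k)%nat) as [E1 [E2 [E3 _]]]. rewrite E1.
      assert (0 <= S (n + k)%nat * w) by (apply Rmult_le_pos; [left; apply HSp|trivial]).
      assert (0 <= S (n + k)%nat * h) by (apply Rmult_le_pos; [left; apply HSp|trivial]).
      destruct E2 as [-> | ->], E3 as [-> | ->]; lra. }
  (* Every left end lies below every right end, so the supremum of the left ends belongs to all the
     nested intervals. *)
  assert (Hcross : forall n m, X n <= X m + S m * w /\ Y n <= Y m + S m * h).
  { intros n m.
    assert (0 <= S n * w) by (apply Rmult_le_pos; [left; apply HSp|trivial]).
    assert (0 <= S n * h) by (apply Rmult_le_pos; [left; apply HSp|trivial]).
    assert (0 <= S m * w) by (apply Rmult_le_pos; [left; apply HSp|trivial]).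
    assert (0 <= S m * h) by (apply Rmult_le_pos; [left; apply HSp|trivial]).
    destruct (Nat.le_ge_cases n m) as [L|L].
    - generalize (Hmono n (m - n)%nat). replace (n + (m - n))%nat with m by lia. lra.
    - generalize (Hmono m (n - m)%nat). replace (m + (n - m))%nat with n by lia. lra. }
  destruct (completeness (fun t => exists n, t = X n)) as [xi [Hx1 Hx2]].
  { exists (X 0%nat + S 0%nat * w). intros t [n ->]. apply Hcross. }
  { exists (X 0%nat). now exists 0%nat. }
  destruct (completeness (fun t => exists n, t = Y n)) as [eta [Hy1 Hy2]].
  { exists (Y 0%nat + S 0%nat * h). intros t [n ->]. apply Hcross. }
  { exists (Y 0%nat). now exists 0%nat. }
  assert (Hxi : forall n, X n <= xi <= X n + S n * w).
  { intros n. split; [apply Hx1; now exists n|]. apply Hx2. intros t [m ->]. apply Hcross. }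
  assert (Heta : forall n, Y n <= eta <= Y n + S n * h).
  { intros n. split; [apply Hy1; now exists n|]. apply Hy2. intros t [m ->]. apply Hcross. }
  destruct (Hloc xi eta) as [del [Hd H]].
  { generalize (Hxi 0%nat). change (X 0%nat) with x0. change (S 0%nat) with 1. lra. }
  { generalize (Heta 0%nat). change (Y 0%nat) with y0. change (S 0%nat) with 1. lra. }
  destruct (pow_lt_1_zero (/ 2)) with (y := del) as [n Hlim]; trivial.
  { rewrite Rabs_pos_eq; lra. }
  apply (HN n). generalize (Hmono 0%nat n). simpl (0 + n)%nat.
  change (X 0%nat) with x0. change (Y 0%nat) with y0. change (S 0%nat) with 1.
  intros [M1 [M2 [M3 M4]]].
  apply H; trivial; try lra; try apply Hxi; try apply Heta.
  split; [apply HSp|]. specialize (Hlim n (Nat.le_refl n)). rewrite <- HS in Hlim.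
  rewrite Rabs_pos_eq in Hlim; trivial. left; apply HSp.
Qed.

(* [P] selects the admissible bounds: all reals to show that [u] is bounded, the
   reals below the supremum to show that the supremum is attained. *)
Lemma disc_max_aux (a : C) (r : R) (u : C -> R) (P : R -> Prop) :
  0 <= r ->
  (forall c d, P c -> P d -> P (Rmax c d)) -> (exists c, P c) ->
  (forall z, Cmod (z - a) <= r -> exists del c, 0 < del /\ P c /\
      forall w, Cmod (w - z) < del -> u w <= c) ->
  exists c, P c /\ forall z, Cmod (z - a) <= r -> u z <= c.
Proof.
  intros Hr HPm [c0 Hc0] Hloc.
  set (Q := fun x y s => exists c, P c /\
    forall z, x <= Re z <= x + s * (2 * r) -> y <= Im z <= y + s * (2 * r) ->
      Cmod (z - a) <= r -> u z <= c).
  cut (Q (Re a - r) (Im a - r) 1).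
  { intros [c [Hc H]]. exists c. split; trivial. intros z Hz.
    assert (H1 := Rle_trans _ _ _ (re_le_Cmod (z - a)) Hz).
    assert (H2 := Rle_trans _ _ _ (Im_le_Cmod (z - a)) Hz).
    apply Rabs_le_between in H1, H2. simpl in H1, H2. unfold Re, Im in *.
    apply H; trivial; lra. }
  apply (quarter_induction (2 * r) (2 * r)); try lra.
  - intros x y s [c1 [P1 H1]] [c2 [P2 H2]] [c3 [P3 H3]] [c4 [P4 H4]].
    exists (Rmax (Rmax c1 c2) (Rmax c3 c4)). split; [auto|].
    intros z Hx Hy Hz.
    generalize (Rmax_l (Rmax c1 c2) (Rmax c3 c4)) (Rmax_r (Rmax c1 c2) (Rmax c3 c4))
      (Rmax_l c1 c2) (Rmax_r c1 c2) (Rmax_l c3 c4) (Rmax_r c3 c4). intros.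
    destruct (Rle_dec (Re z) (x + s / 2 * (2 * r))), (Rle_dec (Im z) (y + s / 2 * (2 * r))).
    + specialize (H1 z). lra.
    + specialize (H3 z). lra.
    + specialize (H2 z). lra.
    + specialize (H4 z). lra.
  - intros xi eta _ _.
    destruct (Rle_dec (Cmod ((xi, eta) - a)) r) as [Hz|Hz].
    + destruct (Hloc _ Hz) as [d [c [Hd [Hc H]]]].
      exists (d / (4 * r + 1)). split; [apply Rdiv_lt_0_compat; lra|].
      intros x y s Hs Hx Hy _ _ _ _. exists c. split; trivial.
      intros z Zx Zy _. apply H.
      eapply Rle_lt_trans; [apply Cmod_le_Re_Im|].
      assert (Hsd : s * (4 * r + 1) < d).
      { apply Rmult_lt_reg_r with (/ (4 * r + 1)); [apply Rinv_0_lt_compat; lra|].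
        rewrite Rmult_assoc, Rinv_r by lra. unfold Rdiv in Hs. lra. }
      assert (Rabs (Re (z - (xi, eta))) <= s * (2 * r)).
      { apply Rabs_le. simpl. unfold Re in *. lra. }
      assert (Rabs (Im (z - (xi, eta))) <= s * (2 * r)).
      { apply Rabs_le. simpl. unfold Im in *. lra. }
      lra.
    (* Around a point outside the closed disc, small rectangles miss the disc and the bound is
       vacuous. *)
    + apply Rnot_le_lt in Hz. set (e := Cmod ((xi, eta) - a) - r).
      exists (e / (4 * r + 1)). split; [apply Rdiv_lt_0_compat; unfold e; lra|].
      intros x y s Hs Hx Hy _ _ _ _. exists c0. split; trivial.
      intros z Zx Zy Hza. exfalso.
      assert (Hsd : s * (4 * r + 1) < e).
      { apply Rmult_lt_reg_r with (/ (4 * r + 1)); [apply Rinv_0_lt_compat; lra|].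
        rewrite Rmult_assoc, Rinv_r by lra. unfold Rdiv in Hs. lra. }
      assert (Rabs (Re (z - (xi, eta))) <= s * (2 * r)).
      { apply Rabs_le. simpl. unfold Re in *. lra. }
      assert (Rabs (Im (z - (xi, eta))) <= s * (2 * r)).
      { apply Rabs_le. simpl. unfold Im in *. lra. }
      generalize (Cmod_le_Re_Im (z - (xi, eta))) (Cmod_triangle ((xi, eta) - z) (z - a)).
      rewrite (Cmod_sub_sym (xi, eta) z).
      replace ((xi, eta) - z + (z - a))%C with ((xi, eta) - a)%C by ring.
      unfold e in *. lra.
Qed.

Lemma disc_max (a : C) (r : R) (u : C -> R) :
  0 <= r -> (forall z, Cmod (z - a) <= r -> @continuous CU R_UniformSpace u z) ->
  exists m, Cmod (m - a) <= r /\ forall z, Cmod (z - a) <= r -> u z <= u m.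
Proof.
  intros Hr Hc.
  assert (Ha : Cmod (a - a) <= r).
  { replace (a - a)%C with (RtoC 0) by ring. now rewrite Cmod_0. }
  destruct (disc_max_aux a r u (fun _ => True)) as [B [_ HB]]; trivial.
  { now exists 0. }
  { intros z Hz. destruct (proj1 (continuous_CR_iff _ _) (Hc z Hz) 1) as [d [Hd H]]; [lra|].
    exists d, (u z + 1). repeat split; trivial. intros w Hw.
    apply H, Rabs_def2 in Hw. lra. }
  destruct (completeness (fun t => exists z, Cmod (z - a) <= r /\ t = u z)) as [M [HM1 HM2]].
  { exists B. intros t [z [Hz ->]]. now apply HB. }
  { exists (u a). now exists a. }
  apply NNPP. intros Hno.
  assert (Hlt : forall z, Cmod (z - a) <= r -> u z < M).
  { intros z Hz. destruct (HM1 (u z)) as [H|H]; [now exists z|trivial|].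
    elim Hno. exists z. split; trivial. intros w Hw. rewrite H. apply HM1. now exists w. }
  (* If the supremum [M] is not attained, [u] stays below [(M + u z)/2 < M] near each [z]. Bounds
     below [M] are stable under maxima, so some bound below [M] holds on the whole disc, which is
     absurd. *)
  destruct (disc_max_aux a r u (fun c => c < M)) as [c [Hc1 Hc2]]; trivial.
  { intros; now apply Rmax_lub_lt. }
  { exists (M - 1). lra. }
  { intros z Hz. specialize (Hlt z Hz).
    destruct (proj1 (continuous_CR_iff _ _) (Hc z Hz) ((M - u z) / 2)) as [d [Hd H]]; [lra|].
    exists d, ((M + u z) / 2). repeat split; trivial; [lra|]. intros w Hw.
    apply H, Rabs_def2 in Hw. lra. }
  apply (Rlt_irrefl M). apply Rle_lt_trans with c; trivial.
  apply HM2. intros t [z [Hz ->]]. now apply Hc2.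
Qed.

(** * Goursat's theorem and circular means *)

(** With [dz = dx] on horizontal sides and [dz = i dy] on vertical ones, these are the imaginary
    parts of the integral of [K dz]. In logarithmic polar coordinates the vertical integrals become
    circular means of a real part. *)
Definition horizontal_int (K : C -> C) (a b c : R) : R := RInt (fun x => Im (K (x, c))) a b.
Definition vertical_int (K : C -> C) (c d a : R) : R := RInt (fun y => Re (K (a, y))) c d.

(* The imaginary part of the integral of [K] along the boundary of [a,b] * [c,d]. *)
Definition boundary_int (K : C -> C) (a b c d : R) : R :=
  horizontal_int K a b c - horizontal_int K a b d
  + vertical_int K c d b - vertical_int K c d a.

Lemma continuous_horizontal (K : C -> C) (x y : R) : @continuous CU CU K (x, y) ->
  continuous (fun t => Im (K (t, y))) x.
Proof.
  intros H. apply continuous_Im. apply (@continuous_comp _ CU CU (fun t => (t, y)) K); trivial.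
  apply continuous_C_of_parts; simpl; [apply continuous_id|apply continuous_const].
Qed.

Lemma continuous_vertical (K : C -> C) (x y : R) : @continuous CU CU K (x, y) ->
  continuous (fun t => Re (K (x, t))) y.
Proof.
  intros H. apply continuous_Re. apply (@continuous_comp _ CU CU (fun t => (x, t)) K); trivial.
  apply continuous_C_of_parts; simpl; [apply continuous_const|apply continuous_id].
Qed.

Section Goursat.
Context (K : C -> C) (x0 y0 w h : R).
Hypothesis Hw : 0 <= w.
Hypothesis Hh : 0 <= h.
Hypothesis Hd : forall x y, x0 <= x <= x0 + w -> y0 <= y <= y0 + h ->
  exists l, has_deriv K (x, y) l.

Let ex_horizontal a b c : x0 <= a -> a <= b -> b <= x0 + w -> y0 <= c <= y0 + h ->
  ex_RInt (fun x => Im (K (x, c))) a b.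
Proof.
  intros. apply @ex_RInt_continuous. intros z. rewrite Rmin_left, Rmax_right by trivial.
  intros Hz. apply continuous_horizontal. destruct (Hd z c) as [l Hl]; try lra.
  exact (has_deriv_continuous _ _ _ Hl).
Qed.

Let ex_vertical a c d : y0 <= c -> c <= d -> d <= y0 + h -> x0 <= a <= x0 + w ->
  ex_RInt (fun y => Re (K (a, y))) c d.
Proof.
  intros. apply @ex_RInt_continuous. intros z. rewrite Rmin_left, Rmax_right by trivial.
  intros Hz. apply continuous_vertical. destruct (Hd a z) as [l Hl]; try lra.
  exact (has_deriv_continuous _ _ _ Hl).
Qed.

Let horizontal_split a m b c : x0 <= a -> a <= m -> m <= b -> b <= x0 + w -> y0 <= c <= y0 + h ->
  horizontal_int K a b c = horizontal_int K a m c + horizontal_int K m b c.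
Proof.
  intros. unfold horizontal_int. symmetry.
  apply (RInt_Chasles (fun x => Im (K (x, c)))); apply ex_horizontal; lra.
Qed.

Let vertical_split c m d a : y0 <= c -> c <= m -> m <= d -> d <= y0 + h -> x0 <= a <= x0 + w ->
  vertical_int K c d a = vertical_int K c m a + vertical_int K m d a.
Proof.
  intros. unfold vertical_int. symmetry.
  apply (RInt_Chasles (fun y => Re (K (a, y)))); apply ex_vertical; lra.
Qed.

Let quarter a m b c n d : x0 <= a -> a <= m -> m <= b -> b <= x0 + w ->
  y0 <= c -> c <= n -> n <= d -> d <= y0 + h ->
  boundary_int K a b c d = boundary_int K a m c n + boundary_int K m b c n
    + boundary_int K a m n d + boundary_int K m b n d.
Proof.
  intros. unfold boundary_int.
  rewrite (horizontal_split a m b c), (horizontal_split a m b d) by lra.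
  rewrite (vertical_split c n d a), (vertical_split c n d b) by lra. ring.
Qed.

Let diff_bound (f g : R -> R) (a b k e : R) : a <= b -> ex_RInt f a b -> ex_RInt g a b ->
  (forall t, a <= t <= b -> Rabs (f t - g t - k) <= e) ->
  Rabs (RInt f a b - RInt g a b - (b - a) * k) <= (b - a) * e.
Proof.
  intros Hab Hf Hg H.
  assert (E : is_RInt (fun t => f t - g t - k) a b (RInt f a b - RInt g a b - (b - a) * k)).
  { apply (is_RInt_minus (V := R_NormedModule) (fun t => f t - g t) (fun _ => k)).
    - apply (is_RInt_minus (V := R_NormedModule) f g);
        now apply (RInt_correct (V := R_CompleteNormedModule)).
    - exact (is_RInt_const (V := R_NormedModule) a b k). }
  rewrite <- (is_RInt_unique _ _ _ _ E). apply abs_RInt_le_const; trivial.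
  now exists (RInt f a b - RInt g a b - (b - a) * k).
Qed.

(** The bound scales with the square of the half-perimeter: each quarter carries a fourth of it, so
    it passes from the quarters to the whole. On small rectangles it follows from the affine
    approximation of [K]. *)
Lemma boundary_int_bound (e : R) : 0 < e ->
  Rabs (boundary_int K x0 (x0 + w) y0 (y0 + h)) <= 2 * e * ((w + h) * (w + h)).
Proof.
  intros He.
  set (P := fun x y s => 0 < s -> x0 <= x -> x + s * w <= x0 + w -> y0 <= y -> y + s * h <= y0 + h ->
    Rabs (boundary_int K x (x + s * w) y (y + s * h)) <= 2 * e * ((s * (w + h)) * (s * (w + h)))).
  assert (HP : P x0 y0 1).
  2: { generalize (HP Rlt_0_1). rewrite !Rmult_1_l. lra. }
  apply (quarter_induction w h); trivial.
  - unfold P. intros x y s H1 H2 H3 H4 Hs Hx Hx' Hy Hy'.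
    assert (0 <= s * w) by (apply Rmult_le_pos; lra).
    assert (0 <= s * h) by (apply Rmult_le_pos; lra).
    rewrite (quarter x (x + s / 2 * w) (x + s * w) y (y + s / 2 * h) (y + s * h)) by lra.
    replace (x + s / 2 * w + s / 2 * w) with (x + s * w) in H2, H4 by field.
    replace (y + s / 2 * h + s / 2 * h) with (y + s * h) in H3, H4 by field.
    specialize (H1 ltac:(lra) ltac:(lra) ltac:(lra) ltac:(lra) ltac:(lra)).
    specialize (H2 ltac:(lra) ltac:(lra) ltac:(lra) ltac:(lra) ltac:(lra)).
    specialize (H3 ltac:(lra) ltac:(lra) ltac:(lra) ltac:(lra) ltac:(lra)).
    specialize (H4 ltac:(lra) ltac:(lra) ltac:(lra) ltac:(lra) ltac:(lra)).
    replace (2 * e * (s / 2 * (w + h) * (s / 2 * (w + h))))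
      with (2 * e * (s * (w + h) * (s * (w + h))) / 4) in H1, H2, H3, H4 by field.
    apply Rabs_le_between in H1, H2, H3, H4. apply Rabs_le. lra.
  - intros xi eta Hxi Heta. destruct (Hd xi eta Hxi Heta) as [l Hl].
    destruct (proj1 (has_deriv_iff _ _ _) Hl e He) as [del [Hdel H]].
    exists (del / (w + h + 1)). split; [apply Rdiv_lt_0_compat; lra|].
    unfold P. intros x y s Hs Hx Hy _ _ _ _ Hs0 Bx Bx' By By'. clear P Hl.
    set (r := s * (w + h)).
    assert (Hsr : r < del).
    { assert (s * (w + h + 1) < del).
      { apply Rmult_lt_reg_r with (/ (w + h + 1)); [apply Rinv_0_lt_compat; lra|].
        rewrite Rmult_assoc, Rinv_r by lra. unfold Rdiv in Hs. lra. }
      unfold r. lra. }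
    assert (Hin : forall u v, x <= u <= x + s * w -> y <= v <= y + s * h ->
      Cmod (K (u, v) - K (xi, eta) - l * ((u, v) - (xi, eta))) <= e * r).
    { intros u v Hu Hv.
      assert (Hr : Cmod ((u, v) - (xi, eta)) <= r).
      { eapply Rle_trans; [apply Cmod_le_Re_Im|]. unfold r. simpl.
        assert (Rabs (u + - xi) <= s * w) by (apply Rabs_le; lra).
        assert (Rabs (v + - eta) <= s * h) by (apply Rabs_le; lra). lra. }
      eapply Rle_trans; [apply H; lra|]. apply Rmult_le_compat_l; lra. }
    assert (0 <= s * w) by (apply Rmult_le_pos; lra).
    assert (0 <= s * h) by (apply Rmult_le_pos; lra).
    (* The affine part of [K] contributes [- (s w)(s h) Re l] through the horizontal sides and the
       opposite amount through the vertical ones; only the error terms survive in the sum. *)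
    assert (B1 : Rabs (horizontal_int K x (x + s * w) y - horizontal_int K x (x + s * w) (y + s * h)
       - (x + s * w - x) * (- (s * h) * Re l)) <= (x + s * w - x) * (2 * (e * r))).
    { apply diff_bound; try lra; try (apply ex_horizontal; lra).
      intros t Ht.
      assert (C1 := Hin t y Ht ltac:(lra)). assert (C2 := Hin t (y + s * h) Ht ltac:(lra)).
      apply (Rle_trans _ _ _ (Im_le_Cmod _)) in C1, C2. simpl in C1, C2.
      apply Rabs_le_between in C1, C2. apply Rabs_le. unfold Re, Im in *. lra. }
    assert (B2 : Rabs (vertical_int K y (y + s * h) (x + s * w) - vertical_int K y (y + s * h) x
       - (y + s * h - y) * (s * w * Re l)) <= (y + s * h - y) * (2 * (e * r))).
    { apply diff_bound; try lra; try (apply ex_vertical; lra).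
      intros t Ht.
      assert (C1 := Hin x t ltac:(lra) Ht). assert (C2 := Hin (x + s * w) t ltac:(lra) Ht).
      apply (Rle_trans _ _ _ (re_le_Cmod _)) in C1, C2. simpl in C1, C2.
      apply Rabs_le_between in C1, C2. apply Rabs_le. unfold Re, Im in *. lra. }
    apply Rabs_le_between in B1, B2. apply Rabs_le. unfold boundary_int.
    replace (2 * e * (r * r)) with (s * w * (2 * (e * r)) + s * h * (2 * (e * r)))
      by (unfold r; ring).
    lra.
Qed.
End Goursat.

Lemma Goursat (K : C -> C) (a b c d : R) : a <= b -> c <= d ->
  (forall x y, a <= x <= b -> c <= y <= d -> exists l, has_deriv K (x, y) l) ->
  boundary_int K a b c d = 0.
Proof.
  intros Hab Hcd Hd.
  assert (B : forall e, 0 < e ->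
    Rabs (boundary_int K a b c d) <= 2 * e * ((b - a + (d - c)) * (b - a + (d - c)))).
  { intros e He. generalize (boundary_int_bound K a c (b - a) (d - c)).
    replace (a + (b - a)) with b by ring. replace (c + (d - c)) with d by ring.
    intros H; apply H; trivial; lra. }
  destruct (Req_dec (boundary_int K a b c d) 0) as [|N]; trivial. exfalso.
  apply Rabs_pos_lt in N. set (q := (b - a + (d - c)) * (b - a + (d - c))) in *.
  assert (Hq : 0 <= q) by apply Rle_0_sqr.
  (* With this [e] the bound reads [|I| <= |I| q/(q + 1)], where [I] is the boundary integral, and
     this is impossible for [I] nonzero. *)
  specialize (B (Rabs (boundary_int K a b c d) / (2 * (q + 1)))
    ltac:(apply Rdiv_lt_0_compat; lra)).
  replace (2 * (Rabs (boundary_int K a b c d) / (2 * (q + 1))) * q)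
    with (Rabs (boundary_int K a b c d) - Rabs (boundary_int K a b c d) / (q + 1)) in B by (field; lra).
  assert (0 < Rabs (boundary_int K a b c d) / (q + 1)) by (apply Rdiv_lt_0_compat; lra).
  lra.
Qed.

(** * The complex exponential *)

Lemma Cmod_Cexp (z : C) : Cmod (Cexp z) = exp (Re z).
Proof.
  unfold Cexp. rewrite Cmod_mult, Cmod_R, Rabs_pos_eq by (left; apply exp_pos).
  replace (Cmod _) with 1; [ring|]. symmetry. unfold Cmod. rewrite <- sqrt_1. f_equal.
  generalize (sin2_cos2 (Im z)). unfold Rsqr. simpl. lra.
Qed.

Lemma Cexp_0 : Cexp 0 = 1.
Proof. unfold Cexp. simpl. rewrite exp_0, cos_0, sin_0. C_ring. Qed.

Lemma Cexp_plus (z w : C) : Cexp (z + w) = (Cexp z * Cexp w)%C.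
Proof. unfold Cexp. simpl. rewrite exp_plus, cos_plus, sin_plus. C_ring. Qed.

Lemma small_increment (f : R -> R) (l : R) : derivable_pt_lim f 0 l ->
  forall e, 0 < e -> exists d, 0 < d /\
    forall x, Rabs x < d -> Rabs (f x - f 0 - l * x) <= e * Rabs x.
Proof.
  intros H e He. destruct (H e He) as [d Hd]. exists d. split; [apply cond_pos|].
  intros x Hx. destruct (Req_dec x 0) as [->|N].
  { replace (f 0 - f 0 - l * 0) with 0 by ring. rewrite Rabs_R0. lra. }
  specialize (Hd x N Hx). rewrite Rplus_0_l in Hd.
  replace (f x - f 0 - l * x) with (((f x - f 0) / x - l) * x) by now field.
  rewrite Rabs_mult. apply Rmult_le_compat_r; [apply Rabs_pos|lra].
Qed.

(** The real derivatives of [exp], [sin] and [cos] at 0 control the real and imaginary parts of the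
    remainder separately. The functional equation carries the result to every other point. *)
Lemma has_deriv_Cexp_0 : has_deriv Cexp 0 1.
Proof.
  (* The error terms [E1] to [E4] add up to at most [8 t |w|], which [t <= e/12] makes smaller than
     [e |w|]; [t <= 1] bounds [exp x] by 3. *)
  apply has_deriv_iff. intros e He. set (t := Rmin 1 (e / 12)).
  assert (Ht : 0 < t) by (apply Rmin_pos; lra).
  assert (Ht1 : t <= 1) by apply Rmin_l.
  assert (Hte : t <= e / 12) by apply Rmin_r.
  assert (D1 : derivable_pt_lim exp 0 1) by (generalize (derivable_pt_lim_exp 0); now rewrite exp_0).
  assert (D2 : derivable_pt_lim sin 0 1) by (generalize (derivable_pt_lim_sin 0); now rewrite cos_0).
  assert (D3 : derivable_pt_lim cos 0 0).
  { generalize (derivable_pt_lim_cos 0). now rewrite sin_0, Ropp_0. }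
  destruct (small_increment _ _ D1 t Ht) as [d1 [Hd1 H1]].
  destruct (small_increment _ _ D2 t Ht) as [d2 [Hd2 H2]].
  destruct (small_increment _ _ D3 t Ht) as [d3 [Hd3 H3]].
  exists (Rmin t (Rmin d1 (Rmin d2 d3))). split.
  { repeat (apply Rmin_pos; [assumption|]). assumption. }
  intros w. replace (w - 0)%C with w by ring. intros Hw.
  assert (G1 := Rmin_l t (Rmin d1 (Rmin d2 d3))). assert (G2 := Rmin_r t (Rmin d1 (Rmin d2 d3))).
  assert (G3 := Rmin_l d1 (Rmin d2 d3)). assert (G4 := Rmin_r d1 (Rmin d2 d3)).
  assert (G5 := Rmin_l d2 d3). assert (G6 := Rmin_r d2 d3).
  assert (Wx := re_le_Cmod w). assert (Wy := Im_le_Cmod w).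
  specialize (H1 (Re w) ltac:(lra)). specialize (H2 (Im w) ltac:(lra)). specialize (H3 (Im w) ltac:(lra)).
  rewrite Cexp_0. rewrite exp_0 in H1. rewrite sin_0 in H2. rewrite cos_0 in H3.
  eapply Rle_trans; [apply Cmod_le_Re_Im|]. unfold Cexp. simpl.
  set (x := Re w) in *. set (y := Im w) in *.
  replace (fst w) with x by reflexivity. replace (snd w) with y by reflexivity.
  set (m := Cmod w) in *. assert (Hm : 0 <= m) by apply Cmod_ge_0.
  set (p := exp x) in *. set (q := sin y) in *. set (k := cos y) in *.
  assert (Hx1 : Rabs x < t) by lra.
  assert (Hy1 : Rabs y < t) by lra.
  assert (Hp : Rabs (p - 1) <= 2 * t).
  { assert (t * Rabs x <= 1 * t) by (generalize (Rabs_pos x); nra).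
    apply Rabs_def2 in Hx1. apply Rabs_le_between in H1. apply Rabs_le. lra. }
  assert (Hp3 : Rabs p <= 3).
  { apply Rabs_le_between in Hp. apply Rabs_le. lra. }
  assert (Hk : Rabs k <= 1) by (apply Rabs_le; apply COS_bound).
  assert (Tm : forall u, Rabs u <= m -> t * Rabs u <= t * m) by (intros; apply Rmult_le_compat_l; lra).
  assert (Hmul : forall u v B D, Rabs u <= B -> Rabs v <= D -> Rabs (u * v) <= B * D).
  { intros. rewrite Rabs_mult. apply Rmult_le_compat; trivial; apply Rabs_pos. }
  assert (E1 : Rabs ((p - 1 - 1 * x) * k) <= t * m * 1).
  { apply Hmul; trivial. specialize (Tm x Wx). lra. }
  assert (E2 : Rabs ((1 + x) * (k - 1)) <= 2 * (t * m)).
  { apply Hmul.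
    - apply Rabs_le. apply Rabs_def2 in Hx1. lra.
    - specialize (Tm y Wy). replace (k - 1) with (k - 1 - 0 * y) by ring. lra. }
  assert (E3 : Rabs (p * (q - 0 - 1 * y)) <= 3 * (t * m)).
  { apply Hmul; trivial. specialize (Tm y Wy). lra. }
  assert (E4 : Rabs ((p - 1) * y) <= 2 * t * m) by (apply Hmul; trivial).
  match goal with |- Rabs ?a + Rabs ?b <= _ =>
    replace a with ((p - 1 - 1 * x) * k + (1 + x) * (k - 1)) by ring;
    replace b with (p * (q - 0 - 1 * y) + (p - 1) * y) by ring end.
  generalize (Rabs_triang ((p - 1 - 1 * x) * k) ((1 + x) * (k - 1)))
    (Rabs_triang (p * (q - 0 - 1 * y)) ((p - 1) * y)). intros.
  assert (t * m <= e / 12 * m) by (apply Rmult_le_compat_r; lra).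
  assert (0 <= e * m) by (apply Rmult_le_pos; lra).
  lra.
Qed.

Lemma has_deriv_Cexp (z : C) : has_deriv Cexp z (Cexp z).
Proof.
  destruct has_deriv_Cexp_0 as [phi [Hc [H1 H]]].
  exists (fun w => (Cexp z * phi (w - z))%C). split; [|split].
  - apply (@continuous_Cmult CU); [apply (@continuous_Cconst CU)|].
    apply (@continuous_comp CU CU CU (fun w => (w - z)%C) phi).
    + apply (@continuous_Cminus CU); [apply continuous_id|apply (@continuous_Cconst CU)].
    + now replace (z - z)%C with (RtoC 0) by ring.
  - replace (z - z)%C with (RtoC 0) by ring. rewrite H1. ring.
  - intros w. specialize (H (w - z)%C). rewrite Cexp_0 in H.
    replace w with (z + (w - z))%C at 1 by ring. rewrite Cexp_plus.
    replace (Cexp z * phi (w - z) * (w - z))%C with (Cexp z * (phi (w - z) * (w - z - 0)))%C by ring.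
    rewrite <- H. ring.
Qed.

(* [x] is the logarithm of the radius. *)
Definition circle_int (F : C -> C) (a : C) (x : R) : R :=
  RInt (fun y => Re (F (a + Cexp (x, y))%C)) 0 (2 * PI).

(** * Means over concentric circles *)

Section CircularMeans.
Context (F : C -> C) (a : C) (R0 : R).
Hypothesis Hd : forall z, 0 < Cmod (z - a) < R0 -> exists l, has_deriv F z l.

Let F_polar x y : exp x < R0 ->
  exists l, has_deriv (fun z => F (a + Cexp z)%C) (x, y) l.
Proof.
  intros Hx. destruct (Hd (a + Cexp (x, y))%C) as [l Hl].
  { replace (a + Cexp (x, y) - a)%C with (Cexp (x, y)) by ring.
    rewrite Cmod_Cexp. split; [apply exp_pos|exact Hx]. }
  exists (l * (0 + Cexp (x, y)))%C.
  apply (has_deriv_comp F (fun z => a + Cexp z)%C); trivial.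
  apply has_deriv_plus; [apply has_deriv_const|apply has_deriv_Cexp].
Qed.

(** The map [a + e^(x + iy)] turns a rectangle of height [2 pi] into an annulus. By periodicity the
    two horizontal sides cancel, so Goursat's theorem equates the two vertical integrals. *)
Lemma circle_int_const (x0 x1 : R) : x0 <= x1 -> exp x1 < R0 ->
  circle_int F a x1 = circle_int F a x0.
Proof.
  intros Hx H1. assert (HPI := PI_RGT_0).
  assert (G : boundary_int (fun z => F (a + Cexp z)%C) x0 x1 0 (2 * PI) = 0).
  { apply Goursat; trivial; [lra|]. intros x y Hx' _. apply F_polar.
    eapply Rle_lt_trans; [|exact H1]. destruct (proj2 Hx') as [L| ->]; [|lra].
    left. now apply exp_increasing. }
  unfold boundary_int in G.
  replace (horizontal_int (fun z => F (a + Cexp z)%C) x0 x1 (2 * PI))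
    with (horizontal_int (fun z => F (a + Cexp z)%C) x0 x1 0) in G.
  2: { apply RInt_ext. intros x _. unfold Cexp. simpl. now rewrite cos_2PI, sin_2PI, cos_0, sin_0. }
  unfold circle_int. unfold vertical_int in G. lra.
Qed.

Let ex_circle x : exp x < R0 -> ex_RInt (fun y => Re (F (a + Cexp (x, y))%C)) 0 (2 * PI).
Proof.
  intros Hx. apply @ex_RInt_continuous. intros y _.
  apply (continuous_vertical (fun z => F (a + Cexp z)%C)).
  destruct (F_polar x y Hx) as [l Hl]. exact (has_deriv_continuous _ _ _ Hl).
Qed.

(** The mean of [Re F] over the circle of radius [r] equals that over a small circle, which by
    continuity at [a] is at least [Re (F a) - eta/2]. Differentiability is assumed only off the
    centre, so that [a] may be the origin for a quotient [h(z)/z]. *)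
Lemma no_strict_mean (r eta : R) : @continuous CU CU F a -> 0 < r < R0 -> 0 < eta ->
  ~ (forall z, Cmod (z - a) = r -> Re (F z) <= Re (F a) - eta).
Proof.
  intros Hc Hr He H. assert (HPI := PI_RGT_0).
  destruct (proj1 (continuous_CU_iff _ _) Hc (eta / 2)) as [d [Hdp HF]]; [lra|].
  set (s := Rmin r (d / 2)).
  assert (Hs : 0 < s) by (apply Rmin_pos; lra).
  assert (Hsr : s <= r) by apply Rmin_l.
  assert (Hsd : s <= d / 2) by apply Rmin_r.
  assert (E : circle_int F a (ln r) = circle_int F a (ln s)).
  { apply circle_int_const; [|rewrite exp_ln; lra].
    destruct Hsr as [L|L]; [left; now apply ln_increasing|right; now rewrite L]. }
  assert (E1 : circle_int F a (ln r) <= (2 * PI) * (Re (F a) - eta)).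
  { replace ((2 * PI) * (Re (F a) - eta)) with (RInt (fun _ => Re (F a) - eta) 0 (2 * PI)).
    2: { rewrite RInt_const. unfold scal; simpl; unfold mult; simpl. ring. }
    apply RInt_le; [lra|apply ex_circle; rewrite exp_ln; lra|apply ex_RInt_const|].
    intros y _. apply H.
    replace (a + Cexp (ln r, y) - a)%C with (Cexp (ln r, y)) by ring.
    rewrite Cmod_Cexp. simpl. apply exp_ln. lra. }
  assert (E2 : (2 * PI) * (Re (F a) - eta / 2) <= circle_int F a (ln s)).
  { replace ((2 * PI) * (Re (F a) - eta / 2)) with (RInt (fun _ => Re (F a) - eta / 2) 0 (2 * PI)).
    2: { rewrite RInt_const. unfold scal; simpl; unfold mult; simpl. ring. }
    apply RInt_le; [lra|apply ex_RInt_const|apply ex_circle; rewrite exp_ln; lra|].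
    intros y _.
    assert (HB : Cmod (F (a + Cexp (ln s, y))%C - F a) < eta / 2).
    { apply HF. replace (a + Cexp (ln s, y) - a)%C with (Cexp (ln s, y)) by ring.
      rewrite Cmod_Cexp. simpl. rewrite exp_ln; lra. }
    assert (HB2 := Rle_lt_trans _ _ _ (re_le_Cmod _) HB). apply Rabs_def2 in HB2.
    simpl in HB2. unfold Re in *. lra. }
  assert (0 < PI * eta) by (apply Rmult_lt_0_compat; lra).
  lra.
Qed.
End CircularMeans.

(** * Schwarz's lemma *)

Lemma disc_near z : disc z -> exists del, 0 < del /\ forall w, Cmod (w - z) < del -> disc w.
Proof.
  unfold disc. intros Hz. exists (1 - Cmod z). split; [lra|]. intros w Hw.
  generalize (Cmod_triangle_rev w z). lra.
Qed.

(* Only continuity is required at the origin, so that the lemma applies to [h(z)/z]. *)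
Lemma max_modulus (k : C -> C) (r B : R) :
  0 < r -> 0 <= B ->
  (forall z, Cmod z <= r -> @continuous CU CU k z) ->
  (forall z, 0 < Cmod z < r -> exists l, has_deriv k z l) ->
  (forall z, Cmod z = r -> Cmod (k z) <= B) ->
  forall a, Cmod a <= r -> Cmod (k a) <= B.
Proof.
  intros Hr HB Hc Hd Hb a Ha.
  assert (Hsq : forall e, 0 < e -> Cmod (k a) * Cmod (k a) <= B * B + e * (r * r)).
  { intros e He.
    (* The term [e |z|^2] makes an interior maximum of [U] strict enough to contradict the mean
       value property; letting [e] tend to 0 recovers the bound for [|k|]. *)
    set (U := fun z => Cmod (k z) * Cmod (k z) + e * (Cmod z * Cmod z)).
    assert (E0 : forall z, (z - 0)%C = z) by (intros; ring).
    destruct (disc_max 0 r U) as [m [Hm Hmax]]; [lra| |].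
    { intros z Hz. rewrite E0 in Hz. unfold U.
      apply (@continuous_plus CU R_AbsRing R_NormedModule).
      - apply (@continuous_mult CU R_AbsRing); apply continuous_Cmod, Hc, Hz.
      - apply (@continuous_mult CU R_AbsRing); [apply continuous_const|].
        apply (@continuous_mult CU R_AbsRing); apply (@continuous_Cmod CU), continuous_id. }
    rewrite E0 in Hm.
    apply Rle_trans with (U m).
    { apply Rle_trans with (U a); [|apply Hmax; now rewrite E0]. unfold U.
      assert (0 <= e * (Cmod a * Cmod a)) by (apply Rmult_le_pos; [lra|apply Rle_0_sqr]). lra. }
    destruct Hm as [Hm|Hm].
    2: { unfold U. rewrite Hm. specialize (Hb m Hm).
         assert (Cmod (k m) * Cmod (k m) <= B * B)
           by (apply Rmult_le_compat; trivial; apply Cmod_ge_0). lra. }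
    exfalso.
    (* [U] differs from [Re F] by a constant and [e |z - m|^2] plus a square. *)
    set (F := fun z => (2 * Cconj (k m) * k z + 2 * RtoC e * Cconj m * z)%C).
    assert (HF : forall z, Re (F z) <= Re (F m) - e * (Cmod (z - m) * Cmod (z - m)) + (U z - U m)).
    { intros z. unfold F, U. rewrite !Cmod_sqr. simpl. unfold Re, Im.
      generalize (Rle_0_sqr (fst (k z) - fst (k m))) (Rle_0_sqr (snd (k z) - snd (k m))).
      unfold Rsqr, Rminus. generalize (k z) (k m). intros [p q] [s t].
      destruct z as [x y], m as [u v]. simpl. nra. }
    (* The disc of radius [R0] about [m] stays in the disc of radius [r] and, unless [m] is the
       origin itself, avoids the origin. *)
    set (R0 := if Ceq_dec m 0 then r else Rmin (r - Cmod m) (Cmod m)).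
    assert (HR0 : 0 < R0 /\ R0 <= r - Cmod m).
    { unfold R0. destruct (Ceq_dec m 0) as [->|N]; [rewrite Cmod_0; lra|].
      apply Cmod_gt_0 in N. split; [apply Rmin_pos; lra|apply Rmin_l]. }
    assert (Hmr : forall z, Cmod z <= Cmod (z - m) + Cmod m).
    { intros z. generalize (Cmod_triangle (z - m) m). now replace (z - m + m)%C with z by ring. }
    apply (no_strict_mean F m R0) with (r := R0 / 2) (eta := e * (R0 / 2 * (R0 / 2))).
    - intros z Hz. destruct (Hd z) as [l Hl].
      { specialize (Hmr z). split; [|lra].
        destruct (Ceq_dec m 0) as [->|N].
        - rewrite E0 in Hz. lra.
        - assert (R0 <= Cmod m) by (unfold R0; destruct (Ceq_dec m 0); [easy|apply Rmin_r]).
          generalize (Cmod_triangle_rev m z). rewrite Cmod_sub_sym. lra. }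
      eexists. apply has_deriv_plus; apply has_deriv_scal; [exact Hl|apply has_deriv_id].
    - apply (@continuous_Cplus CU); apply (@continuous_Cmult CU);
        try apply (@continuous_Cconst CU); [|apply continuous_id].
      apply Hc. lra.
    - lra.
    - apply Rmult_lt_0_compat; [lra|]. apply Rmult_lt_0_compat; lra.
    - intros z Hz. specialize (HF z). rewrite Hz in HF.
      assert (U z <= U m) by (apply Hmax; rewrite E0; specialize (Hmr z); lra). lra. }
  destruct (Rle_dec (Cmod (k a)) B) as [|N]; trivial. exfalso. apply Rnot_le_lt in N.
  set (g := Cmod (k a) * Cmod (k a) - B * B).
  assert (Hg : 0 < g) by (unfold g; nra).
  assert (Hr2 : 0 < r * r) by nra.
  specialize (Hsq (g / (2 * (r * r))) ltac:(apply Rdiv_lt_0_compat; lra)).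
  replace (g / (2 * (r * r)) * (r * r)) with (g / 2) in Hsq by (field; lra).
  unfold g in *. lra.
Qed.

Lemma Schwarz (h : C -> C) :
  (forall z, disc z -> exists l, has_deriv h z l) ->
  (forall z, disc z -> disc (h z)) -> h 0 = 0 ->
  forall z, disc z -> Cmod (h z) <= Cmod z.
Proof.
  intros Hd Hh H0 z Hz.
  assert (D0 : disc 0) by (unfold disc; rewrite Cmod_0; lra).
  (* The factor [k] is [h(w)/w] with the singularity at the origin filled in. *)
  destruct (Hd 0 D0) as [l [k [Kc [_ K]]]].
  assert (Kh : forall w, (h w = k w * w)%C).
  { intros w. specialize (K w). rewrite H0 in K.
    replace (h w) with (h w - 0)%C by ring. rewrite K. ring. }
  assert (Kd : forall w : C, w <> 0 -> disc w -> exists l, has_deriv k w l).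
  { intros w Hw Dw. destruct (Hd w Dw) as [m Hm].
    eexists. apply (has_deriv_near (fun t => h t * / t)%C).
    2: { apply has_deriv_mult; [exact Hm|]. apply has_deriv_inv; [apply has_deriv_id|exact Hw]. }
    destruct (nonzero_near (fun t => t) w) as [d [Hdp Hn]]; [exact (@continuous_id CU w)|exact Hw|].
    exists d. split; trivial. intros t Ht. specialize (Hn t Ht). rewrite Kh. now field. }
  assert (Kcont : forall w, disc w -> @continuous CU CU k w).
  { intros w Hw. destruct (Ceq_dec w 0) as [->|N]; trivial.
    destruct (Kd w N Hw) as [m Hm]. exact (has_deriv_continuous _ _ _ Hm). }
  assert (Hbound : forall r, Cmod z < r < 1 -> r * Cmod (h z) <= Cmod z).
  { intros r Hr. assert (Hz0 := Cmod_ge_0 z).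
    assert (Hk : Cmod (k z) <= / r).
    { apply (max_modulus k r); try lra.
      - left. apply Rinv_0_lt_compat. lra.
      - intros w Hw. apply Kcont. unfold disc. lra.
      - intros w Hw. apply Kd; [apply Cmod_gt_0; lra|unfold disc; lra].
      - intros w Hw. apply Rmult_le_reg_r with r; [lra|]. rewrite Rinv_l by lra.
        rewrite <- Hw. rewrite <- Cmod_mult, <- Kh. left. apply Hh. unfold disc. lra. }
    rewrite Kh, Cmod_mult.
    assert (r * Cmod (k z) <= 1).
    { replace 1 with (r * / r) by (apply Rinv_r; lra). apply Rmult_le_compat_l; lra. }
    rewrite <- Rmult_assoc. rewrite <- (Rmult_1_l (Cmod z)) at 2. now apply Rmult_le_compat_r. }
  apply Rnot_lt_le. intros N. unfold disc in Hz. assert (Hz0 := Cmod_ge_0 z).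
  assert (Hh1 : Cmod (h z) < 1) by now apply Hh.
  (* If [|h z| > |z|], this [r] lies below 1 and above both [|z|] and [|z|/|h z|], which contradicts
     [Hbound]. *)
  set (r := Rmax ((1 + Cmod z) / 2) ((Cmod z / Cmod (h z) + 1) / 2)).
  assert (Hq : Cmod z / Cmod (h z) < 1).
  { apply Rmult_lt_reg_r with (Cmod (h z)); [lra|]. unfold Rdiv.
    rewrite Rmult_assoc, Rinv_l by lra. lra. }
  assert (R1 := Rmax_l ((1 + Cmod z) / 2) ((Cmod z / Cmod (h z) + 1) / 2)).
  assert (R2 := Rmax_r ((1 + Cmod z) / 2) ((Cmod z / Cmod (h z) + 1) / 2)).
  fold r in R1, R2.
  assert (R3 : r < 1) by (apply Rmax_lub_lt; lra).
  specialize (Hbound r ltac:(lra)).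
  assert (Cmod z = Cmod z / Cmod (h z) * Cmod (h z)) by (field; lra).
  assert (Cmod z / Cmod (h z) * Cmod (h z) < r * Cmod (h z)) by (apply Rmult_lt_compat_r; lra).
  lra.
Qed.

(** * The inverse of a univalent function *)

(* Moving from [m] in the direction [- F m / l] decreases [|F|]. *)
Lemma min_modulus_zero (F : C -> C) (m l : C) : has_deriv F m l -> l <> 0 ->
  (exists del, 0 < del /\ forall w, Cmod (w - m) < del -> Cmod (F m) <= Cmod (F w)) -> F m = 0.
Proof.
  intros HF Hl [d [Hdp Hmin]]. apply NNPP. intros N.
  assert (Hl0 : 0 < Cmod l) by now apply Cmod_gt_0.
  assert (HN : 0 < Cmod (F m)) by now apply Cmod_gt_0.
  set (q := (F m / l)%C). assert (Hq : 0 < Cmod q).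
  { unfold q. rewrite Cmod_div by trivial. now apply Rdiv_lt_0_compat. }
  destruct (proj1 (has_deriv_iff _ _ _) HF (Cmod l / 2)) as [d' [Hd' H]]; [lra|].
  set (t := Rmin (1 / 2) (Rmin d d' / (2 * Cmod q))).
  assert (Hdd : 0 < Rmin d d') by now apply Rmin_pos.
  assert (Ht : 0 < t) by (apply Rmin_pos; [lra|apply Rdiv_lt_0_compat; lra]).
  assert (Ht1 : t <= 1 / 2) by apply Rmin_l.
  set (w := (m - RtoC t * q)%C).
  assert (Ew : Cmod (w - m) = t * Cmod q).
  { replace (w - m)%C with (- (RtoC t * q))%C by (unfold w; ring).
    rewrite Cmod_opp, Cmod_mult, Cmod_R, Rabs_pos_eq; lra. }
  assert (Hw : Cmod (w - m) < Rmin d d').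
  { rewrite Ew. apply Rle_lt_trans with (Rmin d d' / (2 * Cmod q) * Cmod q).
    - apply Rmult_le_compat_r; [lra|apply Rmin_r].
    - replace (Rmin d d' / (2 * Cmod q) * Cmod q) with (Rmin d d' / 2) by (field; lra). lra. }
  specialize (Hmin w (Rlt_le_trans _ _ _ Hw (Rmin_l _ _))).
  specialize (H w (Rlt_le_trans _ _ _ Hw (Rmin_r _ _))).
  rewrite Ew in H.
  replace (F w - F m - l * (w - m))%C with (F w - RtoC (1 - t) * F m)%C in H.
  2: { replace (l * (w - m))%C with (- RtoC t * (q * l))%C by (unfold w; ring).
       unfold q. replace (F m / l * l)%C with (F m) by now field. rewrite RtoC_minus. ring. }
  (* The linear approximation of [F w] is [(1 - t) F m], with error at most [t/2 |F m|]. Hence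
     [|F w| <= (1 - t/2) |F m|], against minimality. *)
  assert (Eq : Cmod l / 2 * (t * Cmod q) = t / 2 * Cmod (F m)).
  { unfold q. rewrite Cmod_div by trivial. field. lra. }
  rewrite Eq in H.
  generalize (Cmod_triangle (F w - RtoC (1 - t) * F m) (RtoC (1 - t) * F m)).
  replace (F w - RtoC (1 - t) * F m + RtoC (1 - t) * F m)%C with (F w) by ring.
  rewrite (Cmod_mult (RtoC (1 - t))), Cmod_R, (Rabs_pos_eq (1 - t)) by lra.
  assert (0 < t / 2 * Cmod (F m)) by (apply Rmult_lt_0_compat; lra). lra.
Qed.

(** Reduces questions along a ray to a real function of one variable, to which the mean value
    theorem and sign arguments apply. *)
Lemma real_path_deriv (F : C -> C) (c w l : C) (t : R) : has_deriv F (RtoC t * w)%C l ->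
  derivable_pt_lim (fun s => Re (c * F (RtoC s * w)%C)) t (Re (c * (l * w))).
Proof.
  intros H e He.
  set (B := Cmod c * Cmod w). assert (HB : 0 <= B) by (apply Rmult_le_pos; apply Cmod_ge_0).
  destruct (proj1 (has_deriv_iff _ _ _) H (e / (2 * (B + 1)))) as [d [Hd H']];
    [apply Rdiv_lt_0_compat; lra|].
  assert (Hw := Cmod_ge_0 w).
  assert (Hd2 : 0 < d / (Cmod w + 1)) by (apply Rdiv_lt_0_compat; lra).
  exists (mkposreal _ Hd2). simpl. intros h Hh0 Hh.
  assert (Ed : (RtoC (t + h) * w - RtoC t * w)%C = (RtoC h * w)%C) by (rewrite RtoC_plus; ring).
  specialize (H' (RtoC (t + h) * w)%C). rewrite Ed, Cmod_mult, Cmod_R in H'.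
  assert (Hah : 0 < Rabs h) by now apply Rabs_pos_lt.
  assert (Hsmall : Rabs h * Cmod w < d).
  { assert (Rabs h * (Cmod w + 1) < d).
    { apply Rmult_lt_reg_r with (/ (Cmod w + 1)); [apply Rinv_0_lt_compat; lra|].
      rewrite Rmult_assoc, Rinv_r by lra. unfold Rdiv in Hh. lra. }
    lra. }
  specialize (H' Hsmall).
  set (D := (F (RtoC (t + h) * w) - F (RtoC t * w) - l * (RtoC h * w))%C) in *.
  change (Rabs ((Re (c * F (RtoC (t + h) * w)%C) - Re (c * F (RtoC t * w)%C)) / h - Re (c * (l * w))) < e).
  replace ((Re (c * F (RtoC (t + h) * w)%C) - Re (c * F (RtoC t * w)%C)) / h - Re (c * (l * w)))
    with (Re (c * D) / h).
  2: { replace (c * D)%C with (c * F (RtoC (t + h) * w) - c * F (RtoC t * w) - RtoC h * (c * (l * w)))%C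
         by (unfold D; ring).
       replace (Re (c * F (RtoC (t + h) * w) - c * F (RtoC t * w) - RtoC h * (c * (l * w)))%C)
         with (Re (c * F (RtoC (t + h) * w)%C) - Re (c * F (RtoC t * w)%C) - h * Re (c * (l * w))).
       - field. trivial.
       - rewrite <- re_scal_l. reflexivity. }
  unfold Rdiv. rewrite Rabs_mult, Rabs_inv.
  apply Rmult_lt_reg_r with (Rabs h); trivial. rewrite Rmult_assoc, Rinv_l, Rmult_1_r by lra.
  eapply Rle_lt_trans; [apply re_le_Cmod|]. rewrite Cmod_mult.
  apply Rle_lt_trans with (Cmod c * (e / (2 * (B + 1)) * (Rabs h * Cmod w))).
  { apply Rmult_le_compat_l; [apply Cmod_ge_0|exact H']. }
  replace (Cmod c * (e / (2 * (B + 1)) * (Rabs h * Cmod w)))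
    with ((e * Rabs h) * (B / (2 * (B + 1)))) by (unfold B; field; fold B; lra).
  assert (B / (2 * (B + 1)) < 1).
  { apply Rmult_lt_reg_r with (2 * (B + 1)); [lra|]. unfold Rdiv.
    rewrite Rmult_assoc, Rinv_l by lra. lra. }
  assert (0 < e * Rabs h) by (apply Rmult_lt_0_compat; lra). nra.
Qed.

Section Inverse.
Context (g : C -> C).
Hypothesis Hg : analytic g.
Hypothesis Hinj : forall z1 z2, disc z1 -> disc z2 -> g z1 = g z2 -> z1 = z2.
Hypothesis Hg' : forall z, disc z -> C_derive g z <> 0.

Let Hder z : disc z -> has_deriv g z (C_derive g z).
Proof. intros Hz. apply has_deriv_C_derive, Hg, Hz. Qed.

(** On a small circle about [a], [|g z - g a|] is at least [c r/2], so for [|y - g a| < c r/4] the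
    minimum of [|g z - y|] over the closed disc lies in the interior. There [min_modulus_zero]
    forces it to be 0. *)
Lemma open_mapping a e : disc a -> 0 < e ->
  exists d, 0 < d /\ forall y, Cmod (y - g a) < d -> exists z, Cmod (z - a) < e /\ disc z /\ g z = y.
Proof.
  intros Ha He.
  set (c := Cmod (C_derive g a)). assert (Hc : 0 < c) by (apply Cmod_gt_0, Hg', Ha).
  destruct (disc_near a Ha) as [d1 [Hd1 D1]].
  destruct (proj1 (has_deriv_iff _ _ _) (Hder a Ha) (c / 2)) as [d2 [Hd2 D2]]; [lra|].
  set (r := Rmin e (Rmin d1 d2) / 2).
  assert (Hr0 : 0 < Rmin e (Rmin d1 d2)) by (apply Rmin_pos; trivial; now apply Rmin_pos).
  assert (G1 := Rmin_l e (Rmin d1 d2)). assert (G2 := Rmin_r e (Rmin d1 d2)).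
  assert (G3 := Rmin_l d1 d2). assert (G4 := Rmin_r d1 d2).
  assert (Hr : 0 < r /\ r < e /\ r < d1 /\ r < d2) by (unfold r; lra).
  exists (c * r / 4). split.
  { assert (0 < c * r) by (apply Rmult_lt_0_compat; lra). lra. }
  intros y Hy.
  destruct (disc_max a r (fun z => - Cmod (g z - y))) as [m [Hm Hmax]]; [lra| |].
  { intros z Hz. apply (@continuous_opp CU R_AbsRing R_NormedModule), continuous_Cmod.
    apply (@continuous_Cminus CU); [|apply (@continuous_Cconst CU)].
    eapply has_deriv_continuous, Hder, D1. lra. }
  assert (Dm : disc m) by (apply D1; lra).
  exists m. split; [lra|]. split; trivial.
  assert (Hlow : forall z, Cmod (z - a) = r -> Cmod (g z - y) > Cmod (g a - y)).
  { intros z Hz. specialize (D2 z ltac:(lra)). rewrite Hz in D2.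
    generalize (Cmod_triangle_rev (C_derive g a * (z - a)) (C_derive g a * (z - a) - (g z - g a))).
    replace (C_derive g a * (z - a) - (C_derive g a * (z - a) - (g z - g a)))%C with (g z - g a)%C by ring.
    rewrite (Cmod_sub_sym (C_derive g a * (z - a))).
    rewrite Cmod_mult, Hz. fold c. intros H.
    generalize (Cmod_triangle (g z - y) (y - g a)).
    replace (g z - y + (y - g a))%C with (g z - g a)%C by ring.
    rewrite (Cmod_sub_sym (g a) y). lra. }
  assert (Ha0 : Cmod (a - a) = 0).
  { replace (a - a)%C with (RtoC 0) by ring. apply Cmod_0. }
  assert (Hmr : Cmod (m - a) < r).
  { destruct Hm as [|Hm]; trivial. specialize (Hlow m Hm). specialize (Hmax a). lra. }
  enough (E : (g m - y)%C = 0) by (replace (g m) with (g m - y + y)%C by ring; rewrite E; ring).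
  apply (min_modulus_zero (fun z => g z - y)%C m (C_derive g m + - 0)%C).
  - unfold Cminus. apply has_deriv_plus; [now apply Hder|].
    replace (- 0)%C with (RtoC 0) by ring. apply has_deriv_const.
  - replace (C_derive g m + - 0)%C with (C_derive g m) by ring. now apply Hg'.
  - exists (r - Cmod (m - a)). split; [lra|]. intros w Hw.
    specialize (Hmax w). generalize (Cmod_triangle (w - m) (m - a)).
    replace (w - m + (m - a))%C with (w - a)%C by ring. lra.
Qed.

Definition inverse (w : C) : C := epsilon (inhabits (RtoC 0)) (fun z => disc z /\ g z = w).

Lemma inverse_spec w : image_disc g w -> disc (inverse w) /\ g (inverse w) = w.
Proof. intros H. unfold inverse. apply epsilon_spec. exact H. Qed.

Lemma inverse_left z : disc z -> inverse (g z) = z.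
Proof.
  intros Hz. destruct (inverse_spec (g z)) as [H1 H2]; [now exists z|].
  now apply Hinj.
Qed.

(** If [phi] is the factor of [g] at [inverse w], then [/ phi (inverse y)] is the factor of the
    inverse at [w]. Its continuity rests on that of the inverse, which is the open mapping
    property. *)
Lemma inverse_deriv w : image_disc g w -> has_deriv inverse w (/ C_derive g (inverse w)).
Proof.
  intros Hw. destruct (inverse_spec w Hw) as [Da Ea]. set (a := inverse w) in *.
  assert (Hopen : forall e, 0 < e -> exists d, 0 < d /\ forall y, Cmod (y - w) < d ->
    Cmod (inverse y - a) < e /\ disc (inverse y) /\ g (inverse y) = y).
  { intros e He. destruct (open_mapping a e Da He) as [d [Hd H]]. rewrite Ea in H.
    exists d. split; trivial. intros y Hy. destruct (H y Hy) as [z [H1 [H2 <-]]].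
    now rewrite inverse_left. }
  destruct (Hder a Da) as [phi [Hc [Hl Hphi]]].
  assert (Hcont : @continuous CU CU inverse w).
  { apply continuous_CU_iff. intros e He. destruct (Hopen e He) as [d [Hd H]].
    exists d. split; trivial. intros y Hy. now apply H. }
  assert (Hpc : @continuous CU CU (fun y => phi (inverse y)) w)
    by (apply (@continuous_comp CU CU CU inverse phi); trivial).
  assert (Hp0 : phi (inverse w) <> 0) by (fold a; rewrite Hl; now apply Hg').
  destruct (nonzero_near _ _ Hpc Hp0) as [d1 [Hd1 Hnz]].
  destruct (Hopen 1 Rlt_0_1) as [d2 [Hd2 H2]].
  (* Away from [w] the inverse is arbitrary, while the factor identity must hold everywhere; the
     function is therefore redefined there by the identity itself. *)
  apply (has_deriv_near (fun y => if Rlt_dec (Cmod (y - w)) (Rmin d1 d2) then inverse y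
     else (a + / phi (inverse y) * (y - w))%C)).
  { exists (Rmin d1 d2). split; [now apply Rmin_pos|]. intros y Hy. now destruct Rlt_dec. }
  exists (fun y => / phi (inverse y))%C. split; [|split].
  - now apply (@continuous_Cinv CU).
  - fold a. now rewrite Hl.
  - intros y. replace (w - w)%C with (RtoC 0) by ring. rewrite Cmod_0.
    destruct (Rlt_dec 0 (Rmin d1 d2)) as [_|N]; [|elim N; now apply Rmin_pos].
    destruct (Rlt_dec (Cmod (y - w)) (Rmin d1 d2)) as [L|L]; fold a; [|ring].
    assert (Ny := Hnz y (Rlt_le_trans _ _ _ L (Rmin_l _ _))).
    destruct (H2 y (Rlt_le_trans _ _ _ L (Rmin_r _ _))) as [_ [_ Ey]].
    specialize (Hphi (inverse y)). rewrite Ey, Ea in Hphi. rewrite Hphi. now field.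
Qed.

Hypothesis Hconv : convex_set (image_disc g).
Hypothesis Hg0 : g 0 = 0.

Lemma image_scale t z : 0 <= t <= 1 -> disc z -> image_disc g (RtoC t * g z)%C.
Proof.
  intros Ht Hz.
  replace (RtoC t * g z)%C with (RtoC (1 - t) * 0 + RtoC t * g z)%C by ring.
  apply Hconv; trivial; [|now exists z].
  exists 0. split; trivial. unfold disc. rewrite Cmod_0. lra.
Qed.

(* [g^-1 (t g(z))] maps the disc into itself, so by Schwarz's lemma its modulus,
   as a function of [t], is largest at [t = 1]. *)
Lemma convex_starlike z : disc z -> 0 <= Re (Cconj z * (g z / C_derive g z)).
Proof.
  intros Hz.
  assert (Hle : forall t, 0 <= t <= 1 -> Cmod (inverse (RtoC t * g z)%C) <= Cmod z).
  { intros t Ht. apply (Schwarz (fun z => inverse (RtoC t * g z)%C)); trivial.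
    - intros w Hw. eexists.
      apply (has_deriv_comp inverse (fun w => RtoC t * g w)%C).
      + apply has_deriv_scal, Hder, Hw.
      + apply inverse_deriv. now apply image_scale.
    - intros w Hw. now apply inverse_spec, image_scale.
    - rewrite Hg0. replace (RtoC t * 0)%C with (g 0) by (rewrite Hg0; ring).
      apply inverse_left. unfold disc. rewrite Cmod_0. lra. }
  (* By [Hle], [Re (Cconj z * inverse (t g z))] is at most [|z|^2], with equality at [t = 1], so its
     derivative from the left is nonnegative. For [z] nonzero that derivative is [|z|^2] times the
     real part of [g/(z g')]. *)
  assert (D : derivable_pt_lim (fun t => Re (Cconj z * inverse (RtoC t * g z)%C)) 1
    (Re (Cconj z * (/ C_derive g z * g z)))).
  { apply real_path_deriv. replace (RtoC 1 * g z)%C with (g z) by ring.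
    rewrite <- (inverse_left z Hz) at 2. apply inverse_deriv. now exists z. }
  replace (g z / C_derive g z)%C with (/ C_derive g z * g z)%C by (unfold Cdiv; ring).
  set (L := Re (Cconj z * (/ C_derive g z * g z))) in *.
  apply Rnot_lt_le. intros N.
  destruct (D (- L / 2)) as [d Hd]; [lra|].
  assert (dp := cond_pos d). set (h := - Rmin 1 (d / 2)).
  assert (Hh : 0 < Rmin 1 (d / 2)) by (apply Rmin_pos; lra).
  assert (Hh1 := Rmin_l 1 (d / 2)). assert (Hh2 := Rmin_r 1 (d / 2)).
  specialize (Hd h). rewrite Rabs_left in Hd by (unfold h; lra).
  specialize (Hd ltac:(unfold h; lra) ltac:(unfold h; lra)). cbv beta in Hd.
  replace (RtoC 1 * g z)%C with (g z) in Hd by ring. rewrite (inverse_left z Hz) in Hd.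
  set (I := inverse (RtoC (1 + h) * g z)%C) in *.
  assert (HI : Re (Cconj z * I) <= Re (Cconj z * z)).
  { eapply Rle_trans; [apply Re_le_Cmod|]. rewrite Cmod_mult, Cmod_conj.
    replace (Re (Cconj z * z)) with (Cmod z * Cmod z) by (rewrite Cmod_sqr; simpl; unfold Re, Im; ring).
    apply Rmult_le_compat_l; [apply Cmod_ge_0|]. apply Hle. unfold h. lra. }
  apply Rabs_def2 in Hd.
  assert (Hq : 0 <= (Re (Cconj z * I) - Re (Cconj z * z)) / h).
  { replace ((Re (Cconj z * I) - Re (Cconj z * z)) / h)
      with ((Re (Cconj z * z) - Re (Cconj z * I)) / - h) by (field; unfold h; lra).
    apply Rmult_le_pos; [lra|]. left. apply Rinv_0_lt_compat. unfold h. lra. }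
  lra.
Qed.

(** The mean value theorem plays the part of the integral: with [w = g z], the function
    [Re (c/w * f (g^-1 (t w)))] goes from 0 to [Re (c f/g)], and its derivative is [Re (c f'/g')] at
    [g^-1 (t w)]. *)
Lemma quotient_half_plane (f : C -> C) (c : C) : analytic f -> f 0 = 0 ->
  (forall z, disc z -> 0 < Re (c * (C_derive f z / C_derive g z))) ->
  forall z, disc z -> z <> 0 -> 0 < Re (c * (f z / g z)).
Proof.
  intros Hf Hf0 Hpos z Hz Hz0.
  assert (D0 : disc 0) by (unfold disc; rewrite Cmod_0; lra).
  assert (Hgz : g z <> 0).
  { rewrite <- Hg0. intros E. apply Hz0. now apply Hinj. }
  set (w := g z) in *.
  set (G := fun t : R => inverse (RtoC t * w)%C).
  destruct (MVT_cor2 (fun t => Re (c / w * f (G t)))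
     (fun t => Re (c / w * (C_derive f (G t) * / C_derive g (G t) * w))) 0 1) as [t [Et Ht]].
  - lra.
  - intros t Ht.
    apply (real_path_deriv (fun y => f (inverse y))).
    assert (Hi : image_disc g (RtoC t * w)%C) by now apply image_scale.
    apply (has_deriv_comp f inverse); [now apply inverse_deriv|].
    apply has_deriv_C_derive, Hf. now apply inverse_spec.
  - assert (E0 : G 0 = 0).
    { unfold G. replace (RtoC 0 * w)%C with (g 0) by (rewrite Hg0; ring). now apply inverse_left. }
    assert (E1 : G 1 = z).
    { unfold G. replace (RtoC 1 * w)%C with (g z) by (fold w; ring). now apply inverse_left. }
    rewrite E0, E1, Hf0 in Et.
    replace (c / w * 0)%C with (RtoC 0) in Et by ring.
    replace (c / w * f z)%C with (c * (f z / w))%C in Et by now field.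
    assert (Hi : disc (G t)) by (apply inverse_spec, image_scale; trivial; lra).
    replace (c / w * (C_derive f (G t) * / C_derive g (G t) * w))%C
      with (c * (C_derive f (G t) / C_derive g (G t)))%C in Et
      by (field; split; trivial; now apply Hg').
    specialize (Hpos _ Hi). rewrite re_RtoC in Et. lra.
Qed.
End Inverse.

(** * The principal logarithm *)

(* The complement of the half-line of nonpositive reals. *)
Definition slit (z : C) : Prop := 0 < Cmod z + Re z.

(** The half-angle formula [tan (theta/2) = sin theta / (1 + cos theta)]: one expression, continuous
    on the whole slit plane, without distinction of quadrants. *)
Definition Arg (z : C) : R := 2 * atan (Im z / (Cmod z + Re z)).

Definition Log (z : C) : C := (ln (Cmod z), Arg z).

Lemma slit_Re_pos z : 0 < Re z -> slit z.
Proof. intros H. unfold slit. generalize (Cmod_ge_0 z). lra. Qed.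

(** A nonpositive real [z] would give [Re (z w) = z Re w <= 0]. *)
Lemma slit_quotient z w : 0 < Re (z * w) -> 0 <= Re w -> slit z.
Proof.
  intros H Hw. unfold slit. apply Rnot_le_lt. intros N.
  assert (Hz : Cmod z <= - Re z) by lra. assert (Hp := Cmod_ge_0 z).
  assert (Hsq : Cmod z * Cmod z <= (- Re z) * (- Re z)) by (apply Rmult_le_compat; lra).
  rewrite Cmod_sqr in Hsq.
  assert (HI : Im z = 0) by nra.
  rewrite re_mult, HI in H. nra.
Qed.

Lemma slit_Cmod_pos z : slit z -> 0 < Cmod z.
Proof.
  unfold slit. intros H. generalize (Re_le_Cmod z). lra.
Qed.

Lemma Arg_bound z : Rabs (Arg z) < PI.
Proof.
  unfold Arg. generalize (atan_bound (Im z / (Cmod z + Re z))). intros.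
  apply Rabs_def1; lra.
Qed.

Lemma Arg_bound_Re_pos z : 0 < Re z -> Rabs (Arg z) < PI / 2.
Proof.
  intros H. assert (Hy := Im_le_Cmod z). assert (Hs := slit_Re_pos z H). unfold slit in Hs.
  apply Rabs_le_between in Hy.
  unfold Arg. set (t := Im z / (Cmod z + Re z)).
  assert (Et : t * (Cmod z + Re z) = Im z) by (unfold t; field; lra).
  assert (Ht : -1 < t < 1) by nra.
  assert (H1 := atan_increasing t 1 (proj2 Ht)).
  assert (H2 := atan_increasing (Ropp 1) t (proj1 Ht)).
  rewrite atan_opp in H2. rewrite atan_1 in H1, H2. apply Rabs_def1; lra.
Qed.

Lemma Arg_polar z : slit z -> z = (Cmod z * cos (Arg z), Cmod z * sin (Arg z)).
Proof.
  intros Hs. assert (Hm := slit_Cmod_pos z Hs). unfold slit in Hs.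
  assert (Hsq := Cmod_sqr z). unfold Arg.
  set (m := Cmod z) in *. set (t := Im z / (m + Re z)).
  (* As [t] is the tangent of half the argument, this value of [1 + t²] turns the double-angle
     formulas into [Re z / m] and [Im z / m]. *)
  assert (E : 1 + t² = 2 * m / (m + Re z)).
  { unfold t, Rsqr. replace (Im z / (m + Re z) * (Im z / (m + Re z)))
      with ((Im z * Im z) / ((m + Re z) * (m + Re z))) by (field; lra).
    replace (Im z * Im z) with (m * m - Re z * Re z) by lra. field. lra. }
  assert (Ep : 0 < 1 + t²) by (generalize (Rle_0_sqr t); lra).
  assert (Hq : sqrt (1 + t²) * sqrt (1 + t²) = 1 + t²) by (apply sqrt_sqrt; lra).
  assert (Hq0 : 0 < sqrt (1 + t²)) by now apply sqrt_lt_R0.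
  rewrite cos_2a_cos, sin_2a, cos_atan, sin_atan.
  assert (Ec : 2 * (1 / sqrt (1 + t²)) * (1 / sqrt (1 + t²)) - 1 = Re z / m).
  { replace (2 * (1 / sqrt (1 + t²)) * (1 / sqrt (1 + t²)) - 1)
      with (2 / (sqrt (1 + t²) * sqrt (1 + t²)) - 1) by (field; lra).
    rewrite Hq, E. field. lra. }
  assert (Es : 2 * (t / sqrt (1 + t²)) * (1 / sqrt (1 + t²)) = Im z / m).
  { replace (2 * (t / sqrt (1 + t²)) * (1 / sqrt (1 + t²)))
      with (2 * t / (sqrt (1 + t²) * sqrt (1 + t²))) by (field; lra).
    rewrite Hq, E. unfold t. field. lra. }
  rewrite Ec, Es. apply C_ext; simpl; field; lra.
Qed.

Lemma Arg_unique (m theta : R) : 0 < m -> Rabs theta < PI ->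
  Arg (m * cos theta, m * sin theta) = theta.
Proof.
  intros Hm Ht. apply Rabs_def2 in Ht. unfold Arg.
  assert (E : Cmod (m * cos theta, m * sin theta) = m).
  { apply Rsqr_inj; [apply Cmod_ge_0|lra|]. unfold Rsqr. rewrite Cmod_sqr. simpl.
    generalize (sin2_cos2 theta). unfold Rsqr. nra. }
  rewrite E. simpl.
  set (a := theta / 2). assert (Ha : - (PI / 2) < a < PI / 2) by (unfold a; lra).
  assert (Hc : 0 < cos a) by (apply cos_gt_0; lra).
  replace theta with (2 * a) by (unfold a; field).
  rewrite cos_2a_cos, sin_2a.
  replace (m * (2 * sin a * cos a) / (m + m * (2 * cos a * cos a - 1))) with (tan a).
  - rewrite atan_tan; trivial.
  - unfold tan. field. assert (0 < m * (cos a * cos a)) by (repeat apply Rmult_lt_0_compat; trivial). lra.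
Qed.

Lemma Cexp_Log z : slit z -> Cexp (Log z) = z.
Proof.
  intros Hs. rewrite (Arg_polar z Hs) at 2. unfold Cexp, Log. simpl.
  rewrite exp_ln by now apply slit_Cmod_pos. C_ring.
Qed.

Lemma Log_Cexp (x y : R) : Rabs y < PI -> Log (Cexp (x, y)) = (x, y).
Proof.
  intros Hy. unfold Log. rewrite Cmod_Cexp. simpl. rewrite ln_exp. f_equal.
  rewrite <- (Arg_unique (exp x) y) at 2; trivial; [|apply exp_pos].
  f_equal. unfold Cexp. simpl. C_ring.
Qed.

Section LogContinuity.
Context {U : UniformSpace} (f : U -> C) (x : U).
Hypothesis Hf : @continuous U CU f x.
Hypothesis Hs : slit (f x).

Lemma continuous_Arg : continuous (fun t => Arg (f t)) x.
Proof.
  unfold Arg. apply (@continuous_mult U R_AbsRing); [apply continuous_const|].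
  apply (@continuous_comp U R_UniformSpace R_UniformSpace
    (fun t => Im (f t) / (Cmod (f t) + Re (f t))) atan); [|apply continuous_atan].
  apply (@continuous_mult U R_AbsRing).
  - now apply continuous_Im.
  - apply (@continuous_comp U R_UniformSpace R_UniformSpace (fun t => Cmod (f t) + Re (f t)) Rinv).
    + apply (@continuous_plus U R_AbsRing R_NormedModule); [now apply continuous_Cmod|now apply continuous_Re].
    + apply continuous_Rinv. unfold slit in Hs. lra.
Qed.

Lemma continuous_Log : @continuous U CU (fun t => Log (f t)) x.
Proof.
  apply continuous_C_of_parts; simpl; [|exact continuous_Arg].
  apply (@continuous_comp U R_UniformSpace R_UniformSpace (fun t => Cmod (f t)) ln).
  - now apply continuous_Cmod.
  - apply continuity_pt_filterlim, derivable_continuous_pt.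
    exists (/ Cmod (f x)). apply derivable_pt_lim_ln. now apply slit_Cmod_pos.
Qed.
End LogContinuity.

(** * The bound on the imaginary part *)

(** The values of [D] lie in [2 pi Z]. If [D r] were positive, the intermediate value theorem would
    give a value in [(0, 1]], where the cosine is less than 1. *)
Lemma continuous_angle_nonpos (D : R -> R) (r : R) : 0 <= r ->
  (forall t, 0 <= t <= r -> continuity_pt D t) ->
  (forall t, 0 <= t <= r -> cos (D t) = 1) -> D 0 = 0 -> D r <= 0.
Proof.
  intros Hr Hc Hcos H0. apply Rnot_lt_le. intros N.
  assert (Hr0 : 0 < r) by (destruct Hr as [|E]; trivial; subst r; lra).
  set (y := Rmin (D r / 2) 1). assert (HP := PI_RGT_0). assert (HP2 := PI2_1).
  assert (Hy : 0 < y) by (apply Rmin_pos; lra).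
  assert (Hy1 : y <= D r / 2) by apply Rmin_l. assert (Hy2 : y <= 1) by apply Rmin_r.
  destruct (IVT_interv (fun t => D t - y) 0 r) as [t [Ht E]]; try lra.
  { intros a Ha. apply continuity_pt_minus; [now apply Hc|apply continuity_pt_const; now intros ? ?]. }
  specialize (Hcos t Ht). replace (D t) with y in Hcos by lra.
  generalize (cos_decreasing_1 0 y). rewrite cos_0, Hcos. lra.
Qed.

Lemma continuous_angle_eq_0 (D : R -> R) (r : R) : 0 <= r ->
  (forall t, 0 <= t <= r -> continuity_pt D t) ->
  (forall t, 0 <= t <= r -> cos (D t) = 1) -> D 0 = 0 -> D r = 0.
Proof.
  intros Hr Hc Hcos H0. apply Rle_antisym; [now apply continuous_angle_nonpos|].
  generalize (continuous_angle_nonpos (fun t => - D t) r Hr). intros H.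
  assert (- D r <= 0); [|lra]. apply H.
  - intros t Ht. now apply continuity_pt_opp, Hc.
  - intros t Ht. rewrite cos_neg. auto.
  - lra.
Qed.

(* [F] is [f(z)/z] with the removable singularity at the origin filled in. *)
Lemma divide_by_z (f : C -> C) : analytic f -> normalized f ->
  exists F : C -> C, (forall z, disc z -> @continuous CU CU F z) /\ F 0 = 1 /\
    forall z, (f z = F z * z)%C.
Proof.
  intros Hf [H0 H1].
  assert (D0 : disc 0) by (unfold disc; rewrite Cmod_0; lra).
  destruct (has_deriv_C_derive f 0 (Hf 0 D0)) as [F [Fc [F0 HF]]].
  assert (E : forall z, (f z = F z * z)%C).
  { intros z. specialize (HF z). rewrite H0 in HF.
    replace (f z) with (f z - 0)%C by ring. rewrite HF. ring. }
  exists F. split; [|split]; trivial.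
  - intros z Hz. destruct (Ceq_dec z 0) as [->|N]; trivial.
    destruct (nonzero_near (fun t => t) z) as [d [Hd Hn]]; [exact (@continuous_id CU z)|exact N|].
    apply (@continuous_ext_loc CU CU _ (fun t => f t / t)%C).
    + exists (mkposreal d Hd). intros t Ht. specialize (Hn t Ht). change ((f t / t)%C = F t). rewrite E. now field.
    + apply (@continuous_Cdiv CU); [exact N| |apply continuous_id].
      exact (has_deriv_continuous _ _ _ (has_deriv_C_derive f z (Hf z Hz))).
  - rewrite F0. replace (C_derive f 0) with (C_derive f 0 - 1 + 1)%C by ring. rewrite H1. ring.
Qed.

(** Congruence modulo [2 pi] is expressed by a cosine equal to 1, the form in which
    [continuous_angle_eq_0] takes it. *)
Lemma polar_angle_eq (L S M : C) : slit S -> slit M -> (M = S * Cexp L)%C ->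
  cos (Im L - (Arg M - Arg S)) = 1.
Proof.
  intros HS HM E.
  assert (PS := slit_Cmod_pos S HS). assert (PM := slit_Cmod_pos M HM).
  assert (Em : Cmod M = Cmod S * exp (Re L)) by (rewrite E, Cmod_mult, Cmod_Cexp; reflexivity).
  assert (E1 := Arg_polar S HS). assert (E2 := Arg_polar M HM).
  set (a := Arg S) in *. set (b := Arg M) in *.
  assert (HR := f_equal Re E2). assert (HI := f_equal Im E2).
  assert (SR := f_equal Re E1). assert (SI := f_equal Im E1). simpl in HR, HI, SR, SI.
  clearbody a b. rewrite Em in HR, HI. rewrite E, re_mult in HR. rewrite E, im_mult in HI.
  rewrite SR, SI in HR, HI. unfold Cexp in HR, HI. simpl in HR, HI.
  assert (Hk : 0 < Cmod S * exp (Re L)) by (apply Rmult_lt_0_compat; [trivial|apply exp_pos]).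
  replace (Im L - (b - a)) with ((a + Im L) - b) by ring.
  rewrite cos_minus, cos_plus, sin_plus.
  assert (C1 : cos a * cos (Im L) - sin a * sin (Im L) = cos b).
  { apply Rmult_eq_reg_l with (Cmod S * exp (Re L)); [|lra]. rewrite <- HR. ring. }
  assert (C2 : sin a * cos (Im L) + cos a * sin (Im L) = sin b).
  { apply Rmult_eq_reg_l with (Cmod S * exp (Re L)); [|lra]. rewrite <- HI. ring. }
  rewrite C1, C2. generalize (sin2_cos2 b). unfold Rsqr. lra.
Qed.

Lemma Im_log_bound (f L : C -> C) (r : R) : close_to_convex f -> log_branch (zf'_over_f f) L ->
  0 <= r < 1 -> Rabs (Im (L r)) < 3 * PI / 2.
Proof.
  intros [Hf [Nf [g [lambda [[Ng [[Hg Hinj] Hconv]] [Hlam Hpos]]]]]] [HLc [HL0 HL]] Hr.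
  assert (HPI := PI_RGT_0).
  assert (D0 : disc 0) by (unfold disc; rewrite Cmod_0; lra).
  assert (Hg' : forall z, disc z -> C_derive g z <> 0).
  { intros z Hz E. specialize (Hpos z Hz). rewrite E in Hpos.
    unfold Cdiv, Cinv in Hpos. simpl in Hpos. unfold Rdiv in Hpos.
    rewrite Ropp_0, !Rmult_0_l, !Rmult_0_r in Hpos. simpl in Hpos.
    unfold Re, Im, RtoC in Hpos. simpl in Hpos. lra. }
  destruct Nf as [Hf0 Nf], Ng as [Hg0 Ng].
  destruct (divide_by_z f Hf (conj Hf0 Nf)) as [F [Fc [F0 HF]]].
  destruct (divide_by_z g Hg (conj Hg0 Ng)) as [G [Gc [G0 HG]]].
  set (c := Cexp (Ci * RtoC lambda)) in *.
  assert (Hc : 0 < Re c).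
  { unfold c, Cexp. simpl. apply Rabs_def2 in Hlam.
    replace (0 * 0 + 1 * lambda) with lambda by ring. replace (0 * lambda - 1 * 0) with 0 by ring.
    rewrite exp_0. assert (0 < cos lambda) by (apply cos_gt_0; lra). lra. }
  assert (Gn : forall z, disc z -> G z <> 0).
  { intros z Hz E. destruct (Ceq_dec z 0) as [->|N].
    - rewrite G0 in E. injection E. lra.
    - apply N, Hinj; trivial. rewrite Hg0, HG, E. ring. }
  (* [F/G] is [f/g] with the value 1 at the origin, so [S] and [M] are continuous on the whole
     disc. *)
  set (S := fun z => (c * (F z / G z))%C). set (M := fun z => (S z * Cexp (L z))%C).
  assert (Sc : forall z, disc z -> @continuous CU CU S z).
  { intros z Hz. apply (@continuous_Cmult CU); [apply (@continuous_Cconst CU)|].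
    apply (@continuous_Cdiv CU); auto. }
  assert (Lc : forall z, disc z -> @continuous CU CU L z).
  { intros z Hz. now apply continuous_C_CU, HLc. }
  assert (Mc : forall z, disc z -> @continuous CU CU M z).
  { intros z Hz. apply (@continuous_Cmult CU); auto.
    apply (@continuous_comp CU CU CU L Cexp); auto.
    exact (has_deriv_continuous _ _ _ (has_deriv_Cexp _)). }
  assert (Spos : forall z, disc z -> 0 < Re (S z)).
  { intros z Hz. unfold S. destruct (Ceq_dec z 0) as [->|N].
    - rewrite F0, G0. now replace (c * (1 / 1))%C with c by field.
    - replace (F z / G z)%C with (f z / g z)%C.
      + now apply (quotient_half_plane g).
      + rewrite HF, HG. field. split; auto. }
  assert (Mslit : forall z, disc z -> slit (M z)).
  { intros z Hz. destruct (Ceq_dec z 0) as [->|N].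
    - apply slit_Re_pos. unfold M. rewrite HL0, Cexp_0.
      replace (S 0 * 1)%C with (S 0) by ring. now apply Spos.
    - assert (Fn : F z <> 0).
      { intros E. apply (Rlt_irrefl 0). specialize (Spos z Hz). unfold S in Spos.
        rewrite E in Spos. replace (c * (0 / G z))%C with (RtoC 0) in Spos by (field; auto).
        exact Spos. }
      assert (EM : M z = (c * (C_derive f z / G z))%C).
      { unfold M. rewrite HL by trivial. unfold zf'_over_f, S.
        destruct (Ceq_dec z 0) as [|_]; [easy|]. rewrite HF. field. repeat split; auto. }
      (* [Cconj z * (g/g')] has nonnegative real part, and its product with [M z] is [|z|^2] times
         [c f'/g'], whose real part is positive. *)
      apply (slit_quotient _ (Cconj z * (g z / C_derive g z))).
      + replace (M z * (Cconj z * (g z / C_derive g z)))%C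
          with (RtoC (Cmod z ^ 2) * (c * (C_derive f z / C_derive g z)))%C.
        * rewrite re_scal_l. apply Rmult_lt_0_compat; auto.
          apply pow_lt. now apply Cmod_gt_0.
        * rewrite Cmod2_conj, EM, HG. field. split; auto.
      + now apply convex_starlike. }
  assert (Hdisc : forall t, 0 <= t <= r -> disc (RtoC t)).
  { intros t Ht. unfold disc. rewrite Cmod_R, Rabs_pos_eq; lra. }
  assert (path : forall (V : UniformSpace) (h : C -> V) t, @continuous CU V h (RtoC t) ->
     continuous (fun t : R => h (RtoC t)) t).
  { intros V h t H. apply (@continuous_comp R_UniformSpace CU V RtoC h); trivial.
    apply (@continuous_RtoC R_UniformSpace (fun t => t)), continuous_id. }
  set (A := fun t : R => Arg (M (RtoC t)) - Arg (S (RtoC t))).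
  assert (HA : Im (L r) - A r = 0).
  { apply (continuous_angle_eq_0 (fun t => Im (L (RtoC t)) - A t)); [lra| | |].
    - intros t Ht. assert (Dt := Hdisc t Ht). apply continuity_pt_filterlim.
      apply (@continuous_minus R_UniformSpace R_AbsRing R_NormedModule).
      + apply (path R_UniformSpace (fun z => Im (L z))). now apply (@continuous_Im CU), Lc.
      + apply (@continuous_minus R_UniformSpace R_AbsRing R_NormedModule).
        * apply (path R_UniformSpace (fun z => Arg (M z))). apply (@continuous_Arg CU); auto.
        * apply (path R_UniformSpace (fun z => Arg (S z))). apply (@continuous_Arg CU); auto.
          now apply slit_Re_pos, Spos.
    - intros t Ht. assert (Dt := Hdisc t Ht). apply polar_angle_eq; auto.
      now apply slit_Re_pos, Spos.
    - unfold A, M. rewrite HL0, Cexp_0. replace (S 0 * 1)%C with (S 0) by ring. simpl. lra. }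
  replace (Im (L r)) with (A r) by lra. unfold A.
  assert (Dr : disc (RtoC r)) by (apply Hdisc; lra).
  assert (B1 := Arg_bound (M r)). assert (B2 := Arg_bound_Re_pos _ (Spos _ Dr)).
  apply Rabs_def2 in B1, B2. apply Rabs_def1; lra.
Qed.

(** * The extremal functions *)

(** [|1 - a conj b|^2 - |a - b|^2 = (1 - |a|^2)(1 - |b|^2)]. *)
Lemma pseudo_hyperbolic a b : disc a -> disc b -> Cmod (a - b) < Cmod (1 - a * Cconj b).
Proof.
  unfold disc. intros Ha Hb.
  assert (Pa := Cmod_ge_0 a). assert (Pb := Cmod_ge_0 b).
  assert (A1 : Cmod a * Cmod a < 1) by nra. assert (B1 : Cmod b * Cmod b < 1) by nra.
  apply Rsqr_incrst_0; try apply Cmod_ge_0. unfold Rsqr.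
  rewrite !Cmod_sqr in *. simpl. unfold Re, Im in *.
  destruct a as [a1 a2], b as [b1 b2]. simpl in *. nra.
Qed.

Lemma Re_one_minus_pos a b : disc a -> disc b -> 0 < Re (1 - a * b).
Proof.
  unfold disc. intros Ha Hb.
  assert (H := Re_le_Cmod (a * b)). rewrite Cmod_mult in H.
  assert (Pa := Cmod_ge_0 a). assert (Pb := Cmod_ge_0 b).
  assert (Cmod a * Cmod b < 1) by nra.
  unfold Cminus. rewrite re_plus, re_opp, re_RtoC. lra.
Qed.

Lemma Re_pos_neq_0 z : 0 < Re z -> z <> 0.
Proof. intros H ->. rewrite re_RtoC in H. lra. Qed.

Section Example.
Context (x y : C).
Hypothesis Hx : disc x.
Hypothesis Hy : disc y.

Let p z : C := (1 + - x * z)%C.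
Let q z : C := (1 + - y * z)%C.

(** For [|y| < 1] the image of the disc is again a disc; it becomes a half-plane in the limiting
    case [|y| = 1]. *)
Definition half_plane_map (z : C) : C := (z * / q z)%C.
Definition extremal (z : C) : C := ((z + - ((x + y) / 2) * (z * z)) * / (q z * q z))%C.

Let p_pos z : disc z -> 0 < Re (p z).
Proof. intros Hz. unfold p. replace (1 + - x * z)%C with (1 - x * z)%C by ring. now apply Re_one_minus_pos. Qed.

Let q_pos z : disc z -> 0 < Re (q z).
Proof. intros Hz. unfold q. replace (1 + - y * z)%C with (1 - y * z)%C by ring. now apply Re_one_minus_pos. Qed.

Let q_neq_0 z : disc z -> q z <> 0.
Proof. intros Hz. now apply Re_pos_neq_0, q_pos. Qed.

Let p_neq_0 z : disc z -> p z <> 0.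
Proof. intros Hz. now apply Re_pos_neq_0, p_pos. Qed.

Let p_deriv z : has_deriv p z (0 + - x * 1).
Proof. apply has_deriv_plus; [apply has_deriv_const|apply has_deriv_scal, has_deriv_id]. Qed.

Let q_deriv z : has_deriv q z (0 + - y * 1).
Proof. apply has_deriv_plus; [apply has_deriv_const|apply has_deriv_scal, has_deriv_id]. Qed.

Let g_deriv z : disc z -> has_deriv half_plane_map z (1 / (q z * q z)).
Proof.
  intros Hz. assert (N := q_neq_0 z Hz).
  replace (1 / (q z * q z))%C with (1 * / q z + z * (- (0 + - y * 1) / (q z * q z)))%C.
  - apply (has_deriv_mult (fun w => w) (fun w => / q w)%C); [apply has_deriv_id|].
    now apply has_deriv_inv.
  - assert (E : RtoC 1 = (q z + y * z)%C) by (unfold q; ring).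
    replace (1 / (q z * q z))%C with ((q z + y * z) / (q z * q z))%C by now rewrite <- E.
    generalize (q z) N. intros. now field.
Qed.

Let f_deriv z : disc z -> has_deriv extremal z (p z / (q z * q z * q z)).
Proof.
  intros Hz. assert (N := q_neq_0 z Hz).
  assert (H : has_deriv extremal z
    ((1 + - ((x + y) / 2) * (1 * z + z * 1)) * / (q z * q z)
     + (z + - ((x + y) / 2) * (z * z))
       * (- ((0 + - y * 1) * q z + q z * (0 + - y * 1)) / (q z * q z * (q z * q z))))).
  { apply (has_deriv_mult (fun w => w + - ((x + y) / 2) * (w * w))%C (fun w => / (q w * q w))%C).
    - apply has_deriv_plus; [apply has_deriv_id|].
      apply has_deriv_scal, has_deriv_mult; apply has_deriv_id.
    - apply (has_deriv_inv (fun w => q w * q w)%C); [|now apply Cmult_neq_0].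
      apply has_deriv_mult; apply q_deriv. }
  eapply eq_ind; [exact H|].
  unfold p, q in *. field. exact N.
Qed.

Let extremal_analytic : analytic extremal.
Proof. intros z Hz. eexists. apply is_derive_iff, f_deriv, Hz. Qed.

Let D0 : disc 0.
Proof. unfold disc. rewrite Cmod_0. lra. Qed.

Let q_0 : q 0 = 1.
Proof. unfold q. ring. Qed.

Let extremal_normalized : normalized extremal.
Proof.
  split.
  - unfold extremal. rewrite q_0. ring.
  - rewrite (C_derive_has_deriv _ _ _ (f_deriv 0 D0)), q_0. unfold p. field.
Qed.

(** The inverse Moebius map [w / (1 + y w)] turns [|z| < 1] into this inequality. *)
Let image_half_plane_map w : image_disc half_plane_map w <-> Cmod w < Cmod (1 + y * w).
Proof.
  split.
  - intros [z [Hz <-]]. assert (N := q_neq_0 z Hz).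
    assert (E : (1 + y * half_plane_map z = / q z)%C).
    { unfold half_plane_map. transitivity ((q z + y * z) * / q z)%C; [now field|].
      replace (q z + y * z)%C with (RtoC 1) by (unfold q; ring). ring. }
    rewrite E. unfold half_plane_map. rewrite Cmod_mult.
    assert (P : 0 < Cmod (/ q z)).
    { rewrite Cmod_inv by trivial. apply Rinv_0_lt_compat. now apply Cmod_gt_0. }
    rewrite <- (Rmult_1_l (Cmod (/ q z))) at 2. now apply Rmult_lt_compat_r.
  - intros H. assert (P : 0 < Cmod (1 + y * w)) by (generalize (Cmod_ge_0 w); lra).
    assert (N : (1 + y * w)%C <> 0) by now apply Cmod_gt_0.
    exists (w / (1 + y * w))%C. split.
    + unfold disc. rewrite Cmod_div by trivial.
      apply Rmult_lt_reg_r with (Cmod (1 + y * w)); trivial.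
      unfold Rdiv. rewrite Rmult_assoc, Rinv_l by lra. lra.
    + unfold half_plane_map.
      replace (q (w / (1 + y * w))) with (/ (1 + y * w))%C; [field; exact N|].
      unfold q. field. trivial.
Qed.

Let half_plane_map_convex : convex_function half_plane_map.
Proof.
  split; [|split].
  - split.
    + unfold half_plane_map. ring.
    + rewrite (C_derive_has_deriv _ _ _ (g_deriv 0 D0)), q_0. field.
  - split.
    + intros z Hz. eexists. apply is_derive_iff, g_deriv, Hz.
    + intros z1 z2 H1 H2 E. assert (N1 := q_neq_0 z1 H1). assert (N2 := q_neq_0 z2 H2).
      assert (E' : (z1 * q z2 = z2 * q z1)%C).
      { replace (z1 * q z2)%C with (half_plane_map z1 * (q z1 * q z2))%C
          by (unfold half_plane_map; now field).
        rewrite E. unfold half_plane_map. now field. }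
      replace z1 with (z1 * q z2 + y * (z1 * z2))%C by (unfold q; ring).
      rewrite E'. unfold q. ring.
  - intros u v t Hu Hv Ht. apply image_half_plane_map in Hu, Hv. apply image_half_plane_map.
    assert (sq : forall a b, Cmod a < Cmod b <-> Cmod a * Cmod a < Cmod b * Cmod b).
    { intros a b. generalize (Cmod_ge_0 a) (Cmod_ge_0 b). split; intros; nra. }
    rewrite sq, !Cmod_sqr in *.
    assert (Y : Re y * Re y + Im y * Im y < 1).
    { rewrite <- Cmod_sqr. assert (Py := Cmod_ge_0 y). unfold disc in Hy. nra. }
    clear - Hu Hv Ht Y. simpl in *. unfold Re, Im in *.
    destruct u as [u1 u2], v as [v1 v2], y as [y1 y2]. simpl in *.
    (* [Q] is [|w|^2 - |1 + y w|^2] in real coordinates. Its leading coefficient [K] is positive, so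
       it is a convex function and [Q < 0] describes a convex set. *)
    set (K := 1 - (y1 * y1 + y2 * y2)) in *. assert (HK : 0 < K) by (unfold K; lra).
    set (Q := fun a b => K * (a * a + b * b) - 2 * (y1 * a - y2 * b) - 1).
    assert (HQu : Q u1 u2 < 0) by (unfold Q, K; lra).
    assert (HQv : Q v1 v2 < 0) by (unfold Q, K; lra).
    set (a := (1 - t) * u1 + t * v1). set (b := (1 - t) * u2 + t * v2).
    assert (E : Q a b = (1 - t) * Q u1 u2 + t * Q v1 v2
      - t * (1 - t) * K * ((u1 - v1) * (u1 - v1) + (u2 - v2) * (u2 - v2))) by (unfold Q, a, b; ring).
    assert (0 <= t * (1 - t) * K * ((u1 - v1) * (u1 - v1) + (u2 - v2) * (u2 - v2))).
    { repeat apply Rmult_le_pos; try lra.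
      generalize (Rle_0_sqr (u1 - v1)) (Rle_0_sqr (u2 - v2)). unfold Rsqr. lra. }
    assert (HQ : Q a b < 0) by nra.
    unfold Q, K, a, b in HQ. lra.
Qed.

(* [p/q] maps the disc into the disc with centre [(1 - x ybar) / (1 - |y|^2)],
   which does not contain the origin, so it lies in the half-plane facing the centre. *)
Let ratio_half_plane z : disc z -> 0 < Re (Cconj (1 - x * Cconj y) * (p z / q z)).
Proof.
  intros Hz. assert (N := q_neq_0 z Hz). set (c := (1 - x * Cconj y)%C).
  assert (Dy : disc (Cconj y)) by (unfold disc; now rewrite Cmod_conj).
  assert (H1 : Cmod (x - y) < Cmod c) by now apply pseudo_hyperbolic.
  assert (H2 : Cmod (z - Cconj y) < Cmod (q z)).
  { replace (q z) with (1 - z * Cconj (Cconj y))%C by (rewrite Cconj_conj; unfold q; ring).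
    now apply pseudo_hyperbolic. }
  set (k := 1 - Cmod y * Cmod y).
  assert (Hk : 0 < k).
  { unfold k. assert (Py := Cmod_ge_0 y). unfold disc in Hy. nra. }
  assert (Ek : RtoC k = (1 - y * Cconj y)%C).
  { unfold k. rewrite RtoC_minus, <- Cmod2_conj. simpl. now rewrite Rmult_1_r. }
  apply Rmult_lt_reg_l with k; trivial. rewrite Rmult_0_r, <- re_scal_l.
  (* The identity is [k p/q = c - (x - y)(z - conj y)/q]. The subtracted term has modulus at most
     [|x - y|], which is less than [|c|]. *)
  assert (E : (RtoC k * (Cconj c * (p z / q z)))%C
    = (Cconj c * c - Cconj c * ((x - y) * ((z - Cconj y) / q z)))%C).
  { rewrite Ek. unfold c. generalize (Cconj y) (Cconj (1 - x * Cconj y)). intros yb cb.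
    unfold p, q in *. field. replace (1 - y * z)%C with (1 + - y * z)%C by ring. exact N. }
  rewrite E. unfold Cminus at 1. rewrite re_plus, re_opp.
  assert (Hq : 0 < Cmod (q z)) by now apply Cmod_gt_0.
  assert (B : Re (Cconj c * ((x - y) * ((z - Cconj y) / q z))) <= Cmod c * (Cmod (x - y) * 1)).
  { eapply Rle_trans; [apply Re_le_Cmod|]. rewrite !Cmod_mult, Cmod_conj, Cmod_div by trivial.
    apply Rmult_le_compat_l; [apply Cmod_ge_0|]. apply Rmult_le_compat_l; [apply Cmod_ge_0|].
    apply Rmult_le_reg_r with (Cmod (q z)); trivial.
    unfold Rdiv. rewrite Rmult_assoc, Rinv_l by lra. lra. }
  replace (Re (Cconj c * c)) with (Cmod c * Cmod c) by (rewrite Cmod_sqr; simpl; unfold Re, Im; ring).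
  assert (Pc := Cmod_ge_0 (x - y)). nra.
Qed.

Lemma extremal_close_to_convex : close_to_convex extremal.
Proof.
  split; [exact extremal_analytic|]. split; [exact extremal_normalized|].
  set (c := (1 - x * Cconj y)%C).
  assert (Hc : 0 < Re c).
  { apply Re_one_minus_pos; trivial. unfold disc. now rewrite Cmod_conj. }
  assert (Hm := slit_Cmod_pos c (slit_Re_pos c Hc)).
  (* [|c| e^(- i Arg c)] is the conjugate of [c], the rotation in [ratio_half_plane]; [Re c > 0]
     keeps the angle below [pi/2]. *)
  exists half_plane_map, (- Arg c). split; [exact half_plane_map_convex|].
  split; [rewrite Rabs_Ropp; now apply Arg_bound_Re_pos|].
  intros z Hz. assert (N := q_neq_0 z Hz).
  rewrite (C_derive_has_deriv _ _ _ (g_deriv z Hz)), (C_derive_has_deriv _ _ _ (f_deriv z Hz)).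
  replace (p z / (q z * q z * q z) / (1 / (q z * q z)))%C with (p z / q z)%C.
  2: { generalize (p z) (q z) N. intros. field. repeat split; trivial. }
  apply Rmult_lt_reg_l with (Cmod c); trivial. rewrite Rmult_0_r, <- re_scal_l.
  replace (RtoC (Cmod c) * (Cexp (Ci * RtoC (- Arg c)) * (p z / q z)))%C
    with (Cconj c * (p z / q z))%C; [now apply ratio_half_plane|].
  rewrite Cmult_assoc. f_equal. rewrite (Arg_polar c (slit_Re_pos c Hc)) at 1.
  unfold Cexp. simpl. replace (0 * - Arg c - 1 * 0) with 0 by ring.
  replace (0 * 0 + 1 * - Arg c) with (- Arg c) by ring.
  rewrite exp_0, cos_neg, sin_neg. C_ring.
Qed.

(** Since [f = z (p + q) / (2 q^2)] and [f' = p/q^3], the quotient [z f'/f] is the reciprocal of [q]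
    times [(1 + q/p)/2]. Each factor stays in the slit plane, whereas their product need not. *)
Definition extremal_log (z : C) : C := (- Log (q z) - Log ((1 + q z / p z) / 2))%C.

Let two_neq_0 : RtoC 2 <> 0.
Proof. intros E. apply (f_equal Re) in E. simpl in E. lra. Qed.

(** Multiplied by [2 p], which has positive real part, it becomes [p + q], which has positive real
    part too. *)
Let mean_ratio_slit z : disc z -> slit ((1 + q z / p z) / 2)%C.
Proof.
  intros Hz. assert (P := p_pos z Hz). assert (Q := q_pos z Hz). assert (N := p_neq_0 z Hz).
  apply (slit_quotient _ (RtoC 2 * p z)%C).
  - replace ((1 + q z / p z) / 2 * (2 * p z))%C with (p z + q z)%C by (field; exact N).
    rewrite re_plus. lra.
  - rewrite re_scal_l. lra.
Qed.

Lemma extremal_log_branch : log_branch (zf'_over_f extremal) extremal_log.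
Proof.
  split; [|split].
  - intros z Hz. apply continuous_C_CU.
    assert (Cp : @continuous CU CU p z) by exact (has_deriv_continuous _ _ _ (p_deriv z)).
    assert (Cq : @continuous CU CU q z) by exact (has_deriv_continuous _ _ _ (q_deriv z)).
    apply (@continuous_Cminus CU); [apply (@continuous_Copp CU)|].
    + apply (@continuous_Log CU); trivial. now apply slit_Re_pos, q_pos.
    + apply (@continuous_Log CU); [|now apply mean_ratio_slit].
      apply (@continuous_Cdiv CU); [exact two_neq_0| |apply (@continuous_Cconst CU)].
      apply (@continuous_Cplus CU); [apply (@continuous_Cconst CU)|].
      apply (@continuous_Cdiv CU); auto.
  - assert (L1 : Log 1 = 0).
    { replace (RtoC 1) with (Cexp (0, 0)) by exact Cexp_0. rewrite Log_Cexp; [reflexivity|].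
      rewrite Rabs_R0. exact PI_RGT_0. }
    unfold extremal_log. rewrite q_0. replace (p 0) with (RtoC 1) by (unfold p; ring).
    replace ((1 + 1 / 1) / 2)%C with (RtoC 1) by field. rewrite L1. ring.
  - intros z Hz. assert (Np := p_neq_0 z Hz). assert (Nq := q_neq_0 z Hz).
    set (e := ((1 + q z / p z) / 2)%C).
    assert (He := mean_ratio_slit z Hz). fold e in He.
    assert (Hq := slit_Re_pos _ (q_pos z Hz)).
    assert (Ne : e <> 0) by (apply Cmod_gt_0, slit_Cmod_pos, He).
    assert (E : (Cexp (extremal_log z) * (q z * e))%C = 1).
    { rewrite <- (Cexp_Log (q z) Hq) at 1. rewrite <- (Cexp_Log e He) at 1.
      rewrite <- !Cexp_plus, <- Cexp_0. f_equal. unfold extremal_log. fold e. ring. }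
    replace (Cexp (extremal_log z)) with (/ (q z * e))%C.
    2: { rewrite <- (Cmult_1_r (/ (q z * e))), <- E. field. now split. }
    assert (S : (p z + q z)%C <> 0) by (apply Re_pos_neq_0; rewrite re_plus; generalize (p_pos z Hz) (q_pos z Hz); lra).
    replace (/ (q z * e))%C with (2 * p z / (q z * (p z + q z)))%C by (unfold e; field; repeat split; auto).
    unfold zf'_over_f. destruct (Ceq_dec z 0) as [->|Nz].
    + rewrite q_0. unfold p. field.
    + rewrite (C_derive_has_deriv _ _ _ (f_deriv z Hz)).
      replace (extremal z) with (z * ((p z + q z) / 2) / (q z * q z))%C.
      2: { unfold extremal. replace ((p z + q z) / 2)%C with (1 + - ((x + y) / 2) * z)%C
             by (unfold p, q; field; auto).
           field. auto. }
      field. repeat split; auto.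
Qed.
End Example.

(** * Attaining every point of the strip *)

Lemma strip_attained (w : C) : Rabs (Im w) < 3 * PI / 2 -> LW_1minus w.
Proof.
  destruct w as [X Y]. simpl. intros HY. apply Rabs_def2 in HY. assert (HPI := PI_RGT_0).
  set (al := - Y / 3). assert (Hal : - (PI / 2) < al < PI / 2) by (unfold al; lra).
  assert (Hcos : 0 < cos al) by now apply cos_gt_0.
  set (E := exp (- X)). assert (HE : 0 < E) by apply exp_pos.
  (* [rho <= cos al] gives [|v|^2 <= Re v], hence [|1 - v| < 1]. Together with [rho <= E] it gives
     [rho^2 Re kappa = (2 E - rho) cos al >= rho^2], hence [Re kappa > 1/2]. *)
  set (rho := Rmin E (cos al)). assert (Hrho : 0 < rho) by now apply Rmin_pos.
  assert (HrE : rho <= E) by apply Rmin_l. assert (Hrc : rho <= cos al) by apply Rmin_r.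
  set (lr := ln rho). assert (Elr : exp lr = rho) by now apply exp_ln.
  (* [1 - y r = v] and [1 - x r = / kappa], so that [v/u = v kappa = 2b - 1]. *)
  set (P := fun a b : R => Cexp (a, b)).
  assert (HP : forall a b c d, (P a b * P c d)%C = P (a + c) (b + d)).
  { intros a b c d. unfold P. now rewrite <- Cexp_plus. }
  (* [b] stands for [(1 + v/u)/2], chosen so that [v b = e^(- X - i Y)]: the angles [al] and [2 al]
     add up to [- Y]. Then [kappa] is [(2 b - 1)/v], written with exponentials. *)
  set (v := P lr al). set (b := P (- X - lr) (2 * al)).
  set (kappa := (2 * P (- X - 2 * lr)%R al - P (- lr)%R (- al)%R)%C).
  assert (Evk : (v * kappa = 2 * b - 1)%C).
  { unfold v, kappa, b. unfold Cminus at 1.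
    replace (P lr al * (2 * P (- X - 2 * lr)%R al + - P (- lr)%R (- al)%R))%C
      with (2 * (P lr al * P (- X - 2 * lr)%R al) - P lr al * P (- lr)%R (- al)%R)%C by ring.
    rewrite !HP. replace (lr + (- X - 2 * lr)) with (- X - lr) by ring.
    replace (al + al) with (2 * al) by ring. rewrite !Rplus_opp_r.
    replace (P 0 0) with (RtoC 1) by (symmetry; exact Cexp_0). reflexivity. }
  assert (Rv : Re v = rho * cos al).
  { unfold v, P, Cexp. simpl. rewrite Elr. ring. }
  assert (Mv : Cmod v = rho) by (unfold v, P; rewrite Cmod_Cexp; exact Elr).
  assert (Rk : 1 / 2 < Re kappa).
  { assert (Ek : Re kappa = cos al * (2 * E / (rho * rho) - / rho)).
    { unfold kappa, P, Cexp. simpl. replace (- X - 2 * lr) with (- X + - (lr + lr)) by ring.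
      rewrite exp_plus, !exp_Ropp, exp_plus, Elr, cos_neg. unfold E. rewrite exp_Ropp.
      field. split; [lra|apply Rgt_not_eq, exp_pos]. }
    rewrite Ek. apply Rmult_lt_reg_r with (rho * rho); [now apply Rmult_lt_0_compat|].
    replace (cos al * (2 * E / (rho * rho) - / rho) * (rho * rho)) with (cos al * (2 * E - rho))
      by (field; lra).
    nra. }
  assert (Nk : kappa <> 0) by (apply Re_pos_neq_0; lra).
  assert (Hv : Cmod (1 - v) < 1).
  { apply Rsqr_incrst_0; [|apply Cmod_ge_0|lra]. unfold Rsqr. rewrite Cmod_sqr.
    assert (Hsq := Cmod_sqr v). rewrite Mv in Hsq. rewrite Rv in Hsq.
    assert (rho * rho <= rho * cos al) by (apply Rmult_le_compat_l; lra).
    assert (0 < rho * cos al) by now apply Rmult_lt_0_compat.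
    unfold Cminus. rewrite re_plus, im_plus, re_opp, im_opp, Rv. change (Re (RtoC 1)) with 1. change (Im (RtoC 1)) with 0. lra. }
  (* Inversion maps the half-plane [Re kappa > 1/2] onto the disc of radius 1 about 1. *)
  assert (Hu : Cmod (1 - / kappa) < 1).
  { replace (1 - / kappa)%C with ((kappa - 1) / kappa)%C by now field.
    rewrite Cmod_div by trivial. assert (Pk : 0 < Cmod kappa) by now apply Cmod_gt_0.
    apply Rmult_lt_reg_r with (Cmod kappa); trivial.
    unfold Rdiv. rewrite Rmult_assoc, Rinv_l, Rmult_1_l, Rmult_1_r by lra.
    apply Rsqr_incrst_0; try apply Cmod_ge_0. unfold Rsqr. rewrite !Cmod_sqr.
    unfold Cminus. rewrite re_plus, im_plus, re_opp, im_opp.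
    change (Re (RtoC 1)) with 1. change (Im (RtoC 1)) with 0. lra. }
  set (m := Rmax (Cmod (1 - v)) (Cmod (1 - / kappa))).
  assert (Hm1 : m < 1) by now apply Rmax_lub_lt.
  assert (Hmv : Cmod (1 - v) <= m) by apply Rmax_l.
  assert (Hmu : Cmod (1 - / kappa) <= m) by apply Rmax_r.
  assert (Hm0 : 0 <= m) by (eapply Rle_trans; [apply Cmod_ge_0|exact Hmv]).
  (* Any [r] strictly between [m] and 1 would do: dividing [1 - v] and [1 - / kappa] by it leaves
     [x] and [y] in the open disc. *)
  set (r := (1 + m) / 2). assert (Hr : m < r < 1) by (unfold r; lra).
  assert (Nr : RtoC r <> 0) by (apply Re_pos_neq_0; rewrite re_RtoC; lra).
  assert (Hdiv : forall a, Cmod a <= m -> disc (a / RtoC r)).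
  { intros a Ha. unfold disc. rewrite Cmod_div, Cmod_R, Rabs_pos_eq by (trivial; lra).
    apply Rmult_lt_reg_r with r; [lra|]. unfold Rdiv. rewrite Rmult_assoc, Rinv_l by lra. lra. }
  set (x := ((1 - / kappa) / RtoC r)%C). set (y := ((1 - v) / RtoC r)%C).
  assert (Hx : disc x) by now apply Hdiv. assert (Hy : disc y) by now apply Hdiv.
  exists r. split; [lra|].
  exists (extremal x y), (extremal_log x y).
  split; [now apply extremal_close_to_convex|].
  split; [now apply extremal_log_branch|].
  unfold extremal_log.
  replace (1 + - y * RtoC r)%C with v by (unfold y; now field).
  replace (1 + - x * RtoC r)%C with (/ kappa)%C by (unfold x; field; auto).
  replace ((1 + v / / kappa) / 2)%C with b.
  2: { replace (v / / kappa)%C with (v * kappa)%C by (field; trivial). rewrite Evk. field. }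
  (* Both [al] and [2 al] lie strictly between [- pi] and [pi], so the principal logarithms return
     the chosen exponents. *)
  unfold v, b, P. rewrite !Log_Cexp by (apply Rabs_def1; lra).
  apply C_ext; simpl; unfold al; field.
Qed.

Theorem theorem1p6 :
  forall w : C, LW_1minus w <-> (Rabs (Im w) < 3 * PI / 2)%R.
Proof.
  intros w. split.
  - intros [r [Hr [f [L [Hf [HL ->]]]]]]. now apply (Im_log_bound f).
  - apply strip_attained.
Qed.
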